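(* Suppose the self-similar measure $\mu$ satisfies the standard technical assumptions. Let $x\in[0,1]$ be a periodic point with period $\theta$. Then the local dimension of $\mu$ at $x$ exists and $$\dim\mu(x)=\frac{\log p_0}{\log\varrho}+\frac{\log\big(sp(T(\theta))\big)}{L(\theta^-)\log\varrho},$$ where $sp$ denotes the spectral radius and $L(\theta^-)$ is the length of the path $\theta^-$.
   Context: Measure. Let $m\ge 1$, $0<\varrho<1$, $d_0<\dots<d_m$ real, $S_j(x)=\varrho x+d_j$, $\mathcal A=\{0,\dots,m\}$. For $\sigma=(j_1,\dots,j_n)\in\mathcal A^n$ put $S_\sigma=S_{j_1}\circ\cdots\circ S_{j_n}$. Given $p_j>0$ with $\sum_j p_j=1$, $\mu$ is the unique Borel probability measure with $\mu=\sum_{j=0}^m p_j\,\mu\circ S_j^{-1}$. It is of finite type if there is a finite set $F\subset[0,\infty)$ such that for all $n\ge1$ and $\sigma,\sigma'\in\mathcal A^n$ either $\varrho^{-n}|S_\sigma(0)-S_{\sigma'}(0)|>c$ or $\varrho^{-n}|S_\sigma(0)-S_{\sigma'}(0)|\in F$, where $c=(1-\varrho)^{-1}(d_m-d_0)$. Standard technical assumptions: $\mu$ is such a measure and is of finite type; $p_0=p_m=\min_j p_j$; and $\operatorname{supp}\mu=[0,1]$ (equivalently $d_0=0$, $d_m=1-\varrho$, $d_{i+1}-d_i\le\varrho$ for all $i$). Local dimension. $\dim\mu(x)=\lim_{r\to0^+}\frac{\log\mu([x-r,x+r])}{\log r}$ when the limit exists. Net intervals and characteristic vectors. For $n\ge1$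 let $h_1<\dots<h_{s_n}$ be the distinct elements of $\{S_\sigma(0),S_\sigma(1):\sigma\in\mathcal A^n\}$; the net intervals of level $n$ are $\mathcal F_n=\{[h_j,h_{j+1}]:1\le j<s_n\}$, and $\mathcal F_0=\{[0,1]\}$. Each $\Delta\in\mathcal F_n$ ($n\ge1$) lies in a unique $\widehat\Delta\in\mathcal F_{n-1}$, its parent ($\Delta$ is a child of $\widehat\Delta$). For $\Delta=[a,b]\in\mathcal F_n$ put $\ell_n(\Delta)=\varrho^{-n}(b-a)$, and let $V_n(\Delta)=(a_1,\dots,a_k)$ be the increasing list of the distinct values $\varrho^{-n}(a-S_\sigma(0))$ over $\sigma\in\mathcal A^n$ with $\Delta\subseteq S_\sigma[0,1]$. Let $r_n(\Delta)$ be the position of $\Delta$, from left to right, among the children of $\widehat\Delta$ with the same $\ell_n$ and $V_n$. The characteristic vector is $\mathcal C_n(\Delta)=(\ell_n(\Delta),V_n(\Delta),r_n(\Delta))$, with $\mathcal C_0([0,1])=(1,(0),1)$. $\Omega$ is the (finite) set of all characteristic vectors. $\beta\in\Omega$ is a child of $\alpha\in\Omega$ (its parent) if $\alpha=\mathcal C_{n-1}(\widehat\Delta)$, $\beta=\mathcal C_n(\Delta)$ for some parent/child pair. An admissible path is a tuple $(\gamma_1,\dots,\gamma_n)$ in $\Omega$ with each $\gamma_j$ the parent of $\gamma_{j+1}$; its length is $L=n$. A symbolic representation of $x\in[0,1]$ is $[x]=(\mathcal C_0(\Delta_0),\mathcal C_1(\Delta_1),\dots)$, where $x\in\Delta_n\in\mathcal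 F_n$ and $\Delta_n$ is the parent of $\Delta_{n+1}$ for all $n$ (unique unless $x$ is an endpoint of a net interval, in which case there may be two). Transition matrices. For $\Delta=[a,b]\in\mathcal F_n$ with parent $\widehat\Delta=[c,d]$, $V_n(\Delta)=(a_1,\dots,a_K)$, $V_{n-1}(\widehat\Delta)=(c_1,\dots,c_J)$, the primitive transition matrix $T(\mathcal C_{n-1}(\widehat\Delta),\mathcal C_n(\Delta))$ is the $J\times K$ matrix with $(j,k)$ entry $p_0^{-1}p_\ell$ if $\ell\in\mathcal A$ satisfies $c-\varrho^{n-1}c_j+\varrho^{n-1}d_\ell=a-\varrho^na_k$, and $0$ if there is no such $\ell$ (it depends only on the two characteristic vectors). For an admissible path, $T(\gamma_1,\dots,\gamma_n)=T(\gamma_1,\gamma_2)\cdots T(\gamma_{n-1},\gamma_n)$. Periodic points. $x$ is periodic with period $\theta$ if it has a symbolic representation $(\gamma_0,\dots,\gamma_s,\theta^-,\theta^-,\dots)$, where $\theta$ is an admissible cycle (a path of length at least 2 with equal first and last letters) and $\theta^-$ is $\theta$ with its last letter deleted. Then $T(\theta)$ is a square matrix. *)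

(* Defs.v *)
From HB Require Import structures.
From mathcomp Require Import all_boot all_order all_algebra.
From mathcomp Require Import complex.
From mathcomp Require Import all_classical all_reals all_analysis.

Set Implicit Arguments.
Unset Strict Implicit.
Unset Printing Implicit Defensive.

Import Order.TTheory GRing.Theory Num.Theory.
Import numFieldNormedType.Exports.

Local Open Scope classical_set_scope.
Local Open Scope ring_scope.

Definition spectral_radius (R : realType) (n : nat) (A : 'M[R]_n) : R :=
  sup [set r : R | exists2 z : R[i],
         eigenvalue (map_mx (real_complex R) A) z &
         r = ComplexField.Normc.normc z].

Definition measure_support (R : realType)
    (mu : probability (measurableTypeR R) R) : set R :=
  [set x | forall U : set R, open U -> U x -> (0 < mu U)%E].

Definition has_local_dimension (R : realType)
    (mu : probability (measurableTypeR R) R) (x v : R) : Prop :=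
  ln (fine (mu `[x - r, x + r]%classic)) / ln r @[r --> 0^'+] --> v.

Section IteratedFunctionSystem.
Context {R : realType} {m : nat} (rho : R) (d : 'I_m.+1 -> R).

Definition simil (j : 'I_m.+1) (x : R) : R := rho * x + d j.

Definition simil_word (s : seq 'I_m.+1) (x : R) : R := foldr simil x s.

Definition words (n : nat) : seq (n.-tuple 'I_m.+1) := enum {: n.-tuple 'I_m.+1}.

Definition self_similar (p : 'I_m.+1 -> R)
    (mu : probability (measurableTypeR R) R) : Prop :=
  forall A : set (measurableTypeR R), measurable A ->
    mu A = (\sum_(j < m.+1) (p j)%:E * mu (simil j @^-1` A))%E.

Definition finite_type : Prop :=
  exists2 F : seq R, (forall y, y \in F -> 0 <= y) &
    forall n, (1 <= n)%N -> forall s t : n.-tuple 'I_m.+1,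
      let y := rho ^- n * `|simil_word s 0 - simil_word t 0| in
      (1 - rho)^-1 * (d ord_max - d ord0) < y \/ y \in F.

Definition endpoints (n : nat) : seq R :=
  sort <=%R (undup ([seq simil_word s 0 | s : n.-tuple 'I_m.+1 <- words n] ++
                    [seq simil_word s 1 | s : n.-tuple 'I_m.+1 <- words n])).

(* A net interval [a, b] is represented by the pair (a, b).  At level 0 the
   only word is empty, so that this gives the single interval [0, 1]. *)
Definition net_intervals (n : nat) : seq (R * R) :=
  zip (endpoints n) (behead (endpoints n)).

Definition subitv (D E : R * R) : bool := (E.1 <= D.1) && (D.2 <= E.2).

(* [parent n D] is meant for D in net_intervals n.+1. *)
Definition parent (n : nat) (D : R * R) : R * R :=
  head (0, 1) [seq E <- net_intervals n | subitv D E].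

Definition children (n : nat) (E : R * R) : seq (R * R) :=
  [seq D <- net_intervals n.+1 | subitv D E].

Definition nlen (n : nat) (D : R * R) : R := rho ^- n * (D.2 - D.1).

(* For rho > 0 the image of [0, 1] under simil_word s is
   [simil_word s 0, simil_word s 1]. *)
Definition neighbours (n : nat) (D : R * R) : seq R :=
  sort <=%R (undup [seq rho ^- n * (D.1 - simil_word s 0)
    | s : n.-tuple 'I_m.+1 <- words n
    & subitv D (simil_word s 0, simil_word s 1)]).

(* Positions are counted from 1. *)
Definition position (n : nat) (D : R * R) : nat :=
  if n is n'.+1 then
    (index D [seq E <- children n' (parent n' D)
               | (nlen n E == nlen n D) &&
                 (neighbours n E == neighbours n D)]).+1
  else 1%N.

Record charvec := CharVec {
  cv_len : R;
  cv_nbs : seq R;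
  cv_pos : nat }.

Definition characteristic (n : nat) (D : R * R) : charvec :=
  CharVec (nlen n D) (neighbours n D) (position n D).

Definition parent_child (n : nat) (E D : R * R) : Prop :=
  [/\ E \in net_intervals n, D \in net_intervals n.+1 & subitv D E].

Definition cv_parent_child (alpha beta : charvec) : Prop :=
  exists n E D, [/\ parent_child n E D,
    characteristic n E = alpha & characteristic n.+1 D = beta].

Definition admissible (alpha : charvec) (w : seq charvec) : bool :=
  path (fun a b => `[< cv_parent_child a b >]) alpha w.

Definition symbolic_representation (x : R) (gamma : nat -> charvec) : Prop :=
  exists Delta : nat -> R * R, forall n,
    [/\ Delta n \in net_intervals n,
        x \in `[(Delta n).1, (Delta n).2],
        parent_child n (Delta n) (Delta n.+1) &
        gamma n = characteristic n (Delta n)].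

(* The period is the cycle theta = g :: rcons w g, so that theta^- = g :: w.
   The prefix (gamma_0, ..., gamma_s) is nonempty. *)
Definition periodic_point (x : R) (g : charvec) (w : seq charvec) : Prop :=
  admissible g (rcons w g) /\
  exists2 gamma : nat -> charvec, symbolic_representation x gamma &
    exists s : nat, forall n,
      gamma (s.+1 + n)%N = nth g (g :: w) (n %% size (g :: w)).

(* An entry is determined by the two characteristic vectors: the equation
   does not depend on the parent/child pair (E, D) which realizes them. *)
Definition prim_transition (p : 'I_m.+1 -> R) (alpha beta : charvec) :
    'M[R]_(size (cv_nbs alpha), size (cv_nbs beta)) :=
  \matrix_(j, k)
    if [pick l : 'I_m.+1 | `[< exists n E D,
          [/\ parent_child n E D,
              characteristic n E = alpha,
              characteristic n.+1 D = beta &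
              E.1 - rho ^+ n * (cv_nbs alpha)`_j + rho ^+ n * d l =
              D.1 - rho ^+ n.+1 * (cv_nbs beta)`_k] >]] is Some l
    then (p ord0)^-1 * p l else 0.

(* T of the path alpha :: rcons w beta. *)
Fixpoint transition (p : 'I_m.+1 -> R) (alpha : charvec) (w : seq charvec)
    (beta : charvec) : 'M[R]_(size (cv_nbs alpha), size (cv_nbs beta)) :=
  if w is a :: w' then prim_transition p alpha a *m transition p a w' beta
  else prim_transition p alpha beta.

End IteratedFunctionSystem.

Arguments charvec R : clear implicits.

(* Main.v *)
Require Import Defs.
From mathcomp Require Import all_boot all_order all_algebra.
From mathcomp Require Import complex.
From mathcomp Require Import all_classical all_reals all_analysis.
From mathcomp Require Import ring lra zify.
Import Order.TTheory GRing.Theory Num.Theory.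
Import numFieldNormedType.Exports.
Local Open Scope classical_set_scope.
Local Open Scope ring_scope.

(* For n >= 0 let a_n be the total weight p_sigma of the words sigma of length n whose
   interval S_sigma[0,1] covers the net interval of level n of the given symbolic
   representation of x. Then mu[x - 2 rho^n, x + 2 rho^n] >= a_n, because such a word
   maps [-1, 2] into that ball. Conversely, by the finite type property distinct
   endpoints of level n are at distance at least c rho^n, so a word whose interval
   meets the ball of radius c rho^n / 3 around x either is counted in a_n or ends at
   the unique endpoint h in that ball. The weight of the words ending at h
   is at most (n / p_0) a_n, by an induction using p_0 = p_m = min p_j. Hence the
   local dimension is the limit of log a_n / (n log rho).

   The sequence a_n satisfies p_0 a_n <= a_{n+1} <= a_n, and along a period of length L
   the vector of weights sorted by neighbours is multiplied by p_0^L T(theta), so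
   a_{n+NL} = p_0^{NL} |v T(theta)^N| with v positive. Left eigenvectors bound
   |v T(theta)^N| from below by c |z|^N for each eigenvalue z, and by Cayley-Hamilton
   it satisfies a linear recurrence, whence the upper bound C r^N for all r > sp. *)

(** * Words, their affine maps and their weights *)

Section Words.
Context {R : realType} {m : nat} (rho : R) (d p : 'I_m.+1 -> R).

Local Notation word := (simil_word rho d).

Lemma simil_wordE s x : word s x = word s 0 + rho ^+ size s * x.
Proof.
elim: s x => [|j s IH] x /=; first by rewrite expr0 mul1r add0r.
by rewrite /simil IH exprS; ring.
Qed.

Lemma simil_word_rcons s j x : word (rcons s j) x = word s (rho * x + d j).
Proof. by rewrite /simil_word foldr_rcons. Qed.

Lemma simil_word1 s : word s 1 = word s 0 + rho ^+ size s.
Proof. by rewrite simil_wordE mulr1. Qed.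

Lemma big_tuple_rcons (V : nmodType) n (F : seq 'I_m.+1 -> V) :
  \sum_(t : n.+1.-tuple 'I_m.+1) F t =
  \sum_(s : n.-tuple 'I_m.+1) \sum_(j < m.+1) F (rcons s j).
Proof.
rewrite pair_bigA /=.
pose f (q : n.-tuple 'I_m.+1 * 'I_m.+1) := [tuple of rcons q.1 q.2].
pose g (t : n.+1.-tuple 'I_m.+1) :=
  ([tuple of belast (thead t) (behead t)], last (thead t) (behead t)).
rewrite (reindex f) //=; exists g => [[s j]|t] _.
  rewrite /f /g /=; congr pair; last first.
    by rewrite /thead (tnth_nth ord0) /=; case: (tval s) => //= a l; rewrite last_rcons.
  apply: val_inj => /=; rewrite /thead (tnth_nth ord0) /=.
  by case: (tval s) => //= a l; rewrite belast_rcons.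
by apply: val_inj => /=; rewrite -lastI; case/tupleP: t => a l; rewrite theadE.
Qed.

Definition word_weight (s : seq 'I_m.+1) : R := \prod_(j <- s) p j.

Definition word_sum n (b : pred (seq 'I_m.+1)) : R :=
  \sum_(s : n.-tuple 'I_m.+1 | b s) word_weight s.

(* Half-open intervals select the words covering the net interval on a chosen side
   of y, which matters when y is itself an endpoint. *)
Definition one_sided (e : bool) (u v y : R) : bool :=
  if e then u <= y < v else u < y <= v.

(** This is the weight a_n, expressed through the point [y] alone, so that it can be estimated
    before net intervals enter. *)
Definition cover_weight e n y :=
  word_sum n (fun s => one_sided e (word s 0) (word s 1) y).

(** The boolean doubles as a point: [e%:R] is the end of [0, 1] at which [one_sided e] is open, so
    the words counted here just miss being counted by [cover_weight e n h]. *)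
Definition end_weight (e : bool) n h := word_sum n (fun s => word s e%:R == h).

Context (p_gt0 : forall j, 0 < p j).

Lemma word_weight_gt0 s : 0 < word_weight s.
Proof. by rewrite /word_weight; elim/big_ind: _ => // x y; apply: mulr_gt0. Qed.

Lemma word_weight_rcons s j : word_weight (rcons s j) = word_weight s * p j.
Proof. by rewrite /word_weight -cats1 big_cat big_seq1. Qed.

Lemma word_sumS n b :
  word_sum n.+1 b = \sum_(s : n.-tuple 'I_m.+1)
    word_weight s * \sum_(j < m.+1 | b (rcons s j)) p j.
Proof.
rewrite /word_sum big_mkcond /=.
rewrite (big_tuple_rcons _ _ (fun t => if b t then word_weight t else 0)).
apply: eq_bigr => s _; rewrite mulr_sumr [RHS]big_mkcond /=.
by apply: eq_bigr => j _; rewrite word_weight_rcons.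
Qed.

Lemma word_sum_ge0 n b : 0 <= word_sum n b.
Proof. by apply: sumr_ge0 => s _; apply: ltW; apply: word_weight_gt0. Qed.

Lemma word_sum0 b : word_sum 0 b = (b [::])%:R.
Proof.
rewrite /word_sum big_mkcond /= (big_pred1 [tuple]) => [|t].
  by rewrite /word_weight big_nil; case: (b _).
by rewrite (tuple0 t) /= eqxx.
Qed.

Lemma word_sum_le n (b b' : pred (seq 'I_m.+1)) :
  (forall s, size s = n -> b s -> b' s) -> word_sum n b <= word_sum n b'.
Proof.
move=> bb'; rewrite /word_sum big_mkcond [leRHS]big_mkcond /=.
apply: ler_sum => s _; case: ifP => [/bb' -> //|_]; first by rewrite size_tuple.
by case: ifP => // _; apply: ltW; apply: word_weight_gt0.
Qed.

Lemma word_sumU n (b b' : pred (seq 'I_m.+1)) :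
  word_sum n (fun s => b s || b' s) <= word_sum n b + word_sum n b'.
Proof.
rewrite /word_sum !(big_mkcond (fun s => b _)) !(big_mkcond (fun s => b' _)).
rewrite (big_mkcond (fun s => b _ || b' _)) -big_split /=.
apply: ler_sum => s _; have := word_weight_gt0 s.
by case: (b s); case: (b' s) => /=; lra.
Qed.

End Words.

(** * Change of the covering weights from one level to the next *)

Section Covering.
Context {R : realType} {m : nat} (rho : R) (d p : 'I_m.+1 -> R).
Context (rho01 : 0 < rho < 1).
Context (d_mono : forall i j : 'I_m.+1, (i < j)%N -> d i < d j).
Context (p_gt0 : forall j, 0 < p j) (p_sum1 : \sum_(j < m.+1) p j = 1).
Context (p_ends : p ord0 = p ord_max) (p_min : forall j, p ord0 <= p j).
Context (d0 : d ord0 = 0) (dm : d ord_max = 1 - rho).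
Context (cov : forall y : R, 0 <= y <= 1 -> exists j, d j <= y <= d j + rho).

Local Notation word := (simil_word rho d).
Local Notation cover_weight := (cover_weight rho d p).
Local Notation end_weight := (end_weight rho d p).

Let rho_gt0 : 0 < rho. Proof. by case/andP: rho01. Qed.

Lemma d_inj : injective d.
Proof.
move=> i j dij; apply: val_inj; case: (ltngtP i j) => // /d_mono; rewrite dij ltxx.
all: by [].
Qed.

Lemma d_homo (i j : 'I_m.+1) : (i <= j)%N -> d i <= d j.
Proof.
by rewrite leq_eqVlt => /orP[/eqP/val_inj-> //|/d_mono/ltW].
Qed.

Lemma d_bounds j : 0 <= d j <= 1 - rho.
Proof. by rewrite -d0 -dm !d_homo // -ltnS. Qed.

Lemma word_homo s x y : (word s x <= word s y) = (x <= y).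
Proof. by rewrite simil_wordE [leRHS]simil_wordE lerD2l ler_pM2l ?exprn_gt0. Qed.

Lemma word_inj s : injective (word s).
Proof.
move=> x y e; apply/eqP.
by rewrite eq_le -[x <= y](word_homo s) -[y <= x](word_homo s) e lexx.
Qed.

Lemma word_surj s y : exists x, word s x = y.
Proof.
exists ((y - word s 0) / rho ^+ size s); rewrite simil_wordE mulrC divfK ?subrKC //.
by rewrite expf_eq0 gt_eqF // andbF.
Qed.

Lemma one_sided_word e s u v y :
  one_sided e (word s u) (word s v) (word s y) = one_sided e u v y.
Proof. by rewrite /one_sided !ltNge !word_homo. Qed.

(** For [e] true let [j] be the last image starting at or before [y], and [t] the next starting
    point, or 1. If image [j] ended at or before [y], the midpoint of [y] and [t] would lie in no
    image. The other side is the mirror image. *)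
Lemma one_sided_cover e y :
  one_sided e 0 1 y -> exists j, one_sided e (d j) (d j + rho) y.
Proof.
have r0 := rho_gt0; rewrite /one_sided; case: e => /andP[y0 y1].
  have /(@arg_maxnP _ _ (fun j => d j <= y) (fun j : 'I_m.+1 => val j)) : d ord0 <= y by rewrite d0.
  move=> [j djy jmax]; exists j; rewrite djy /= ltNge; apply/negP => jy.
  pose t := if (j < m)%N then d (inord j.+1) else 1.
  have jt (i : 'I_m.+1) : d i < t -> (i <= j)%N.
    rewrite /t; case: ltnP => [jm|mj _]; last by apply: leq_trans mj; rewrite -ltnS.
    by move=> it; rewrite leqNgt; apply/negP => ji; have := d_homo (inord j.+1) i;
       rewrite inordK // => /(_ ji); rewrite leNgt it.
  have yt : y < t.
    rewrite /t; case: ltnP => [jm|mj //]; rewrite ltNge; apply/negP => /jmax /=.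
    by rewrite inordK // ltnn.
  have t1 : t <= 1.
    by rewrite /t; case: ltnP => // _; have := d_bounds (inord j.+1); lra.
  have [|i /andP[iy yi]] := cov ((y + t) / 2); first by lra.
  by have /jt/d_homo : d i < t by [lra]; lra.
have /(@arg_minnP _ _ (fun j => y <= d j + rho) (fun j : 'I_m.+1 => val j)) :
  y <= d ord_max + rho by rewrite dm; lra.
move=> [j djy jmin]; exists j; rewrite djy andbT ltNge; apply/negP => jy.
pose t := if (0 < j)%N then d (inord j.-1) + rho else 0.
have jt (i : 'I_m.+1) : t < d i + rho -> (j <= i)%N.
  rewrite /t; case: ltnP => [jm|mj _]; last by apply: leq_trans mj _.
  move=> it; rewrite leqNgt; apply/negP => ji; have := d_homo i (inord j.-1).
  rewrite inordK; last by apply: leq_ltn_trans (ltn_ord j); rewrite leq_pred.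
  by rewrite -ltnS prednK // => /(_ ji); lra.
have yt : t < y.
  rewrite /t; case: ltnP => [jm|mj //]; rewrite ltNge; apply/negP => /jmin /=.
  rewrite inordK; last by apply: leq_ltn_trans (ltn_ord j); rewrite leq_pred.
  by rewrite leqNgt ltn_predL jm.
have t1 : 0 <= t.
  by rewrite /t; case: ltnP => // _; have := d_bounds (inord j.-1); lra.
have [|i /andP[iy yi]] := cov ((y + t) / 2); first by lra.
by have /jt/d_homo : t < d i + rho by [lra]; lra.
Qed.

Lemma one_sided_rcons e s j y :
  one_sided e (word (rcons s j) 0) (word (rcons s j) 1) y ->
  one_sided e (word s 0) (word s 1) y.
Proof.
have [z <-] := word_surj s y; rewrite !simil_word_rcons !one_sided_word.
by have := d_bounds j; have := rho_gt0; rewrite /one_sided; case: e; lra.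
Qed.

Lemma p_sum_le1 (b : pred 'I_m.+1) : \sum_(j | b j) p j <= 1.
Proof.
rewrite -p_sum1 [leRHS](bigID b) /= lerDl.
by rewrite sumr_ge0 // => j _; apply: ltW.
Qed.

(** Every counted word has a counted prefix, and the weights of the letters sum to 1. *)
Lemma cover_weight_le e n y : cover_weight e n.+1 y <= cover_weight e n y.
Proof.
rewrite /cover_weight word_sumS /word_sum [leRHS]big_mkcond /=.
apply: ler_sum => s _; have w0 := word_weight_gt0 _ p_gt0 s.
case: ifPn => sy; last first.
  rewrite big1 ?mulr0 // => j jy.
  by move: sy; rewrite (one_sided_rcons _ _ _ _ jy).
by rewrite ger_pMr // p_sum_le1.
Qed.

(** Every counted word has a counted extension by one letter, whose weight is at least [p ord0]. *)
Lemma cover_weight_ge e n y :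
  p ord0 * cover_weight e n y <= cover_weight e n.+1 y.
Proof.
rewrite /cover_weight word_sumS /word_sum mulr_sumr big_mkcond /=.
apply: ler_sum => s _; have w0 := word_weight_gt0 _ p_gt0 s.
case: ifPn => sy; last first.
  by rewrite mulr_ge0 ?sumr_ge0 ?ltW // => j _; apply: ltW.
rewrite mulrC ler_pM2l //.
have [z zy] := word_surj s y; move: sy; rewrite -zy one_sided_word.
case/one_sided_cover => j jz.
rewrite (bigD1 j) /=; last by rewrite !simil_word_rcons one_sided_word mulr0 mulr1 add0r addrC.
by rewrite ler_wpDr // sumr_ge0 // => i _; apply: ltW.
Qed.

Lemma cover_weight0 e y : one_sided e 0 1 y -> cover_weight e 0 y = 1.
Proof. by move=> h; rewrite /cover_weight word_sum0 /= h. Qed.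

Lemma cover_weight_gt0 e n y : one_sided e 0 1 y -> 0 < cover_weight e n y.
Proof.
move=> y01; elim: n => [|n IH]; first by rewrite cover_weight0.
by apply: lt_le_trans (cover_weight_ge _ _ _); rewrite mulr_gt0.
Qed.

(* A word of level n.+1 ending at h either extends, by an extreme letter, a word
   ending at h, or has a prefix whose interval contains h in its interior.
   Since the extreme letters have the least weight p ord0, the first kind
   cannot grow relative to cover_weight. *)
Lemma end_weight_le (e : bool) n (h : R) :
  h != e%:R -> end_weight e n h <= n%:R / p ord0 * cover_weight e n h.
Proof.
have r01 := rho01; move=> he; elim: n => [|n IH].
  by rewrite /end_weight word_sum0 /= eq_sym (negPf he) mul0r mul0r.
have step : end_weight e n.+1 h <= p ord0 * end_weight e n h + cover_weight e n h.
  rewrite /end_weight /cover_weight word_sumS /word_sum mulr_sumr.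
  rewrite !(big_mkcond (fun s => _ == h)) [X in _ + X]big_mkcond -big_split /=.
  apply: ler_sum => s _; have w0 := word_weight_gt0 _ p_gt0 s.
  (* The unique letter whose map fixes the point [e%:R]. *)
  pose je : 'I_m.+1 := if e then ord_max else ord0.
  have pje : p je = p ord0 by rewrite /je; case: e {he IH} je.
  have dje j : (rho * e%:R + d j == e%:R) = (j == je).
    apply/eqP/eqP => [ej|->]; last first.
      by rewrite /je; case: (e) => /=; rewrite ?dm ?d0; lra.
    by apply: d_inj; move: ej; rewrite /je; case: (e) => /=; rewrite ?dm ?d0; lra.
  have [z zh] := word_surj s h; rewrite -zh one_sided_word.
  under eq_bigl => j do rewrite simil_word_rcons (inj_eq (word_inj s)).
  rewrite (inj_eq (word_inj s)).
  have [ez|ez] := eqVneq (e%:R) z.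
    rewrite (big_pred1 je) => [|j]; last by rewrite -ez dje.
    rewrite pje mulrC lerDl.
    by case: ifP => // _; apply: ltW.
  rewrite add0r; case: ifPn => z01.
    by rewrite ger_pMr // p_sum_le1.
  rewrite big1 ?mulr0 // => j /eqP jz; case/negP: z01.
  move: ez; rewrite -jz eq_sym dje => je'.
  have := d_bounds j; have : d j != d je by rewrite (inj_eq d_inj).
  move: rho01; rewrite /one_sided /je; case: (e) => /=; rewrite ?dm ?d0; rewrite lt_neqAle.
    move=> /andP[r0 r1] jm /andP[j0 j1]; apply/andP; split; first lra.
    rewrite lt_neqAle; apply/andP; split; last lra.
    by apply: contra jm => /eqP jm; apply/eqP; lra.
  move=> /andP[r0 r1] jm /andP[j0 j1]; apply/andP; split; last lra.
  rewrite lt_neqAle; apply/andP; split; last lra.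
  by apply: contra jm => /eqP jm; apply/eqP; lra.
apply: le_trans step _.
(* The factor [p ord0] cancels the denominator of the induction hypothesis, giving n + 1 copies of
   the weight of level n; passing to level n + 1 costs a new division by [p ord0]. *)
apply: (@le_trans _ _ (n.+1%:R * cover_weight e n h)).
  rewrite -[n.+1]addn1 natrD mulrDl mul1r lerD2r.
  move: IH; rewrite -(ler_pM2l (p_gt0 ord0)) => /le_trans; apply.
  by rewrite mulrA [p ord0 * _]mulrC divfK // gt_eqF.
rewrite -mulrA ler_wpM2l // ler_pdivlMl //; exact: cover_weight_ge.
Qed.

End Covering.

(** * Powers of nonnegative matrices and the spectral radius *)

Section Growth.
Context {R : realType}.
Local Notation normc := (@ComplexField.Normc.normc R).
Local Notation cplx := (real_complex R).

Lemma normc_real (x : R) : normc (cplx x) = `|x|.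
Proof. by rewrite /= expr0n addr0 sqrtr_sqr. Qed.

Lemma normc_ge0 (z : R[i]) : 0 <= normc z.
Proof. by case: z => a b /=; apply: sqrtr_ge0. Qed.

Lemma normcX (z : R[i]) N : normc (z ^+ N) = normc z ^+ N.
Proof.
elim: N => [|N IH]; first by rewrite !expr0 ComplexField.Normc.normc1.
by rewrite !exprS ComplexField.Normc.normcM IH.
Qed.

Lemma normc_sum (I : Type) (r : seq I) (F : I -> R[i]) :
  normc (\sum_(i <- r) F i) <= \sum_(i <- r) normc (F i).
Proof.
elim: r => [|i r IH]; first by rewrite !big_nil ComplexField.Normc.normc0.
rewrite !big_cons; apply: le_trans (le_normcD _ _) _.
by rewrite lerD2l.
Qed.

(** The constant K = |a_0| + C / (r - |z|) satisfies |z| K + C <= K r, which is what the induction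
    needs. *)
Lemma recurrence_root_bound (z : R[i]) (r : R) (a : nat -> R[i]) :
  normc z < r ->
  (exists C, forall N, normc (a N.+1 - z * a N) <= C * r ^+ N) ->
  exists C, forall N, normc (a N) <= C * r ^+ N.
Proof.
move=> zr [C aC]; have z0 := normc_ge0 z.
have r0 : 0 < r by lra.
have C0 : 0 <= C by have := aC 0; rewrite expr0 mulr1; apply: le_trans; apply: normc_ge0.
exists (normc (a 0) + C / (r - normc z)); elim=> [|N IH].
  by rewrite expr0 mulr1 lerDl divr_ge0 // subr_ge0 ltW.
have -> : a N.+1 = z * a N + (a N.+1 - z * a N) by ring.
apply: le_trans (le_normcD _ _) _; rewrite ComplexField.Normc.normcM.
set K := normc (a 0) + C / (r - normc z) in IH *.
have KE : K * r - normc z * K - C = normc (a 0) * (r - normc z).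
  by rewrite /K; field; rewrite subr_eq0 gt_eqF.
apply: (@le_trans _ _ (normc z * (K * r ^+ N) + C * r ^+ N)).
  by apply: lerD => //; rewrite ler_wpM2l.
rewrite -subr_ge0 exprS.
have -> : K * (r * r ^+ N) - (normc z * (K * r ^+ N) + C * r ^+ N) =
  (K * r - normc z * K - C) * r ^+ N by ring.
by rewrite KE !mulr_ge0 ?normc_ge0 ?exprn_ge0 ?subr_ge0 // ltW.
Qed.

(* By Cayley-Hamilton the sequence [v *m M ^+ N] satisfies the linear recurrence
   given by the characteristic polynomial, whose roots are peeled off one by one. *)
Lemma power_sum_le n (M : 'M[R]_n) (v : 'rV_n) (r : R) :
  (forall z, eigenvalue (map_mx cplx M) z -> normc z < r) ->
  exists C, forall N, \sum_i (v *m M ^+ N) 0 i <= C * r ^+ N.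
Proof.
case: n => [|n] in M v *.
  by move=> _; exists 0 => N; rewrite big_ord0 mul0r.
move=> Mr; pose Mc := map_mx cplx M; pose vc := map_mx cplx v.
(* Linear functional on polynomials under which multiplication by X becomes the step from N to N +
   1. *)
pose L (P : {poly R[i]}) := \sum_i (vc *m horner_mx Mc P) 0 i.
have LB P Q : L (P - Q) = L P - L Q.
  rewrite /L rmorphB /= mulmxBr -sumrB; by apply: eq_bigr => i _; rewrite !mxE.
have LZ z P : L (z *: P) = z * L P.
  rewrite /L linearZ /= -scalemxAr mulr_sumr.
  by apply: eq_bigr => i _; rewrite [LHS]mxE.
have LX N : L 'X^N = cplx (\sum_i (v *m M ^+ N) 0 i).
  rewrite /L rmorphXn /= horner_mx_X rmorph_sum /=.
  have -> : Mc ^+ N = map_mx cplx (M ^+ N) by rewrite /Mc rmorphXn.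
  by apply: eq_bigr => i _; rewrite -map_mxM mxE.
(* Removing one factor X - z leaves a first order recurrence with ratio z, whose inhomogeneous term
   is bounded by the induction hypothesis. *)
have peel (zs : seq R[i]) : (forall z, z \in zs -> normc z < r) -> forall Q,
  (exists C, forall N, normc (L (\prod_(z <- zs) ('X - z%:P) * Q * 'X^N)) <= C * r ^+ N) ->
  exists C, forall N, normc (L (Q * 'X^N)) <= C * r ^+ N.
  elim: zs => [|z zs IH] zsr Q.
    by move=> [C H]; exists C => N; have := H N; rewrite big_nil mul1r.
  move=> [C H]; apply: (@recurrence_root_bound z r (fun N => L (Q * 'X^N))).
    by apply: zsr; rewrite mem_head.
  have [||C' H'] := IH _ (('X - z%:P) * Q).
  - by move=> y yz; apply: zsr; rewrite inE yz orbT.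
  - exists C => N; have := H N; rewrite big_cons.
    by rewrite mulrA [_ * ('X - _)]mulrC.
  exists C' => N; have := H' N; congr (normc _ <= _); rewrite -LZ -LB.
  by congr L; rewrite exprS -mul_polyC; ring.
have [zs zsE] := closed_field_poly_normal (char_poly Mc).
move: zsE; rewrite (monicP (char_poly_monic _)) scale1r => zsE.
have [||C H] := peel zs _ 1.
- by move=> z zz; apply: Mr; rewrite eigenvalue_root_char zsE root_prod_XsubC.
- exists 0 => N; rewrite -zsE mulr1 /L rmorphM /= Cayley_Hamilton mul0r mulmx0.
  by rewrite big1 ?ComplexField.Normc.normc0 ?mul0r // => i _; rewrite mxE.
exists C => N; apply: le_trans (H N); rewrite mul1r LX normc_real.
exact: ler_norm.
Qed.

(** A left eigenvector u satisfies |u| <= K v entrywise, and nonnegativity of [M] carries this over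
    to |z|^N |u_j| <= K (v M^N)_j. *)
Lemma power_sum_ge n (M : 'M[R]_n) (v : 'rV_n) z :
  (forall i j, 0 <= M i j) -> (forall i, 0 < v 0 i) ->
  eigenvalue (map_mx cplx M) z ->
  exists2 c, 0 < c & forall N, c * normc z ^+ N <= \sum_i (v *m M ^+ N) 0 i.
Proof.
move=> M0 v0 /eigenvalueP[u uM u0].
have [j uj] : exists j, u 0 j != 0 by apply/rV0Pn.
have MN0 N i k : 0 <= (M ^+ N) i k.
  elim: N i k => [|N IH] i k; first by rewrite expr0 mxE mulrb; case: ifP.
  by rewrite exprS mxE sumr_ge0 // => l _; rewrite mulr_ge0.
have uMN N : u *m map_mx cplx (M ^+ N) = z ^+ N *: u.
  elim: N => [|N IH]; first by rewrite !expr0 map_mx1 mulmx1 scale1r.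
  by rewrite !exprSr map_mxM mulmxA IH -scalemxAl uM scalerA.
pose K := \sum_i normc (u 0 i) / v 0 i.
have Ki i : normc (u 0 i) <= K * v 0 i.
  rewrite -ler_pdivrMr // /K (bigD1 i) //= lerDl sumr_ge0 // => k _.
  by rewrite divr_ge0 ?normc_ge0 // ltW.
have uj0 : 0 < normc (u 0 j).
  rewrite lt_neqAle normc_ge0 andbT eq_sym; apply: contra uj => /eqP.
  by move/ComplexField.Normc.eq0_normc/eqP.
have K0 : 0 < K by rewrite -(pmulr_lgt0 _ (v0 j)); apply: lt_le_trans (Ki j).
exists (normc (u 0 j) / K); first exact: divr_gt0.
move=> N; rewrite mulrAC ler_pdivrMr // mulrC -normcX -ComplexField.Normc.normcM.
have -> : z ^+ N * u 0 j = (u *m map_mx cplx (M ^+ N)) 0 j by rewrite uMN !mxE.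
rewrite mxE; apply: le_trans (normc_sum _ _ _) _.
apply: (@le_trans _ _ ((v *m M ^+ N) 0 j * K)); last first.
  rewrite ler_wpM2r ?(ltW K0) // (bigD1 j) //= lerDl sumr_ge0 // => i _.
  by rewrite mxE sumr_ge0 // => k _; rewrite mulr_ge0 // ltW.
rewrite mxE mulr_suml; apply: ler_sum => i _.
rewrite ComplexField.Normc.normcM mxE normc_real (ger0_norm (MN0 _ _ _)).
by rewrite mulrAC [X in _ <= X * _]mulrC ler_wpM2r.
Qed.

Lemma eigenvalue_exists n (M : 'M[R]_n) : (0 < n)%N ->
  exists z, eigenvalue (map_mx cplx M) z.
Proof.
move=> n0; have : size (char_poly (map_mx cplx M)) != 1.
  by rewrite size_char_poly eqSS -lt0n.
by move/closed_rootP => [z zr]; exists z; rewrite eigenvalue_root_char.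
Qed.

(** The eigenvalues are the roots of a polynomial of positive degree, so the [sup] in
    [spectral_radius] is a genuine supremum. *)
Lemma spectral_radius_has_sup n (M : 'M[R]_n) : (0 < n)%N ->
  has_sup [set r : R | exists2 z : R[i],
         eigenvalue (map_mx (real_complex R) M) z & r = normc z].
Proof.
move=> n0; split.
  by have [z Mz] := eigenvalue_exists _ M n0; exists (normc z); exists z.
have [zs] := closed_field_poly_normal (char_poly (map_mx cplx M)).
rewrite (monicP (char_poly_monic _)) scale1r => zsE.
exists (\sum_(y <- zs) normc y) => _ [z + ->].
rewrite eigenvalue_root_char zsE root_prod_XsubC => zz.
rewrite (big_rem z) //= lerDl sumr_ge0 // => y _; exact: normc_ge0.
Qed.

(** The lower bound [c] excludes a spectral radius sp below 1, since the sums would then decay. So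
    the logarithm is taken at a positive number, and the sums can be compared with the powers of sp
    exp(e) from above and of sp exp(-e) from below. *)
Lemma spectral_radius_growth n (M : 'M[R]_n) (v : 'rV_n) (c : R) :
  (0 < n)%N -> (forall i j, 0 <= M i j) -> (forall i, 0 < v 0 i) ->
  0 < c -> (forall N, c <= \sum_i (v *m M ^+ N) 0 i) ->
  1 <= spectral_radius M /\
  forall e, 0 < e -> exists C, forall N,
    `|ln (\sum_i (v *m M ^+ N) 0 i) - N%:R * ln (spectral_radius M)|
      <= e * N%:R + C.
Proof.
move=> n0 M0 v0 c0 cu; set sp := spectral_radius M.
pose u N := \sum_i (v *m M ^+ N) 0 i; rewrite -/(u _).
have u0 N : 0 < u N by apply: lt_le_trans (cu N).
have hs := spectral_radius_has_sup _ M n0.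
have spz z : eigenvalue (map_mx cplx M) z -> normc z <= sp.
  by move=> Mz; apply: sup_upper_bound => //; exists z.
have up r : sp < r -> exists C, forall N, ln (u N) <= C + N%:R * ln r.
  move=> spr; have [|C HC] := power_sum_le _ M v r.
    by move=> z /spz zs; apply: le_lt_trans zs spr.
  have r0 : 0 < r.
    have [z Mz] := eigenvalue_exists _ M n0.
    by apply: le_lt_trans spr; apply: le_trans (spz _ Mz); apply: normc_ge0.
  have C0 : 0 < C by have := HC 0; rewrite expr0 mulr1; apply: lt_le_trans (u0 0).
  exists (ln C) => N; rewrite mulr_natl -lnXn // -lnM ?posrE ?exprn_gt0 //.
  by rewrite ler_ln ?posrE ?mulr_gt0 ?exprn_gt0 //; apply: HC.
have sp1 : 1 <= sp.
  rewrite leNgt; apply/negP => lt1.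
  have sp0 : 0 <= sp.
    have [z Mz] := eigenvalue_exists _ M n0.
    by apply: le_trans (spz _ Mz); apply: normc_ge0.
  have [|C HC] := up ((1 + sp) / 2); first by lra.
  have l0 : 0 < - ln ((1 + sp) / 2).
    by rewrite oppr_gt0 ln_lt0 //; apply/andP; split; lra.
  have l1 : 0 <= `|C - ln c| / - ln ((1 + sp) / 2) by rewrite divr_ge0 // ltW.
  have := archi_boundP l1; set N := Num.bound _.
  rewrite ltr_pdivrMr // => HN.
  have : ln c <= ln (u N) by rewrite ler_ln ?posrE //; apply: cu.
  by have := HC N; have := ler_norm (C - ln c); lra.
split=> // e e0.
have sp0 : 0 < sp by lra.
have ee : 1 < expR e by rewrite expR_gt1.
have [|C HC] := up (sp * expR e); first by rewrite ltr_pMr.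
have [|_ [z Mz ->] zsp] := @sup_adherent _ _ (sp - sp * expR (- e)) _ hs.
  rewrite subr_gt0 gtr_pMr //; by rewrite expR_lt1 oppr_lt0.
have [c' c'0 Hc'] := power_sum_ge _ M v z M0 v0 Mz.
have {}zsp : sp * expR (- e) < normc z 
  by have : sp - (sp - sp * expR (- e)) < normc z by [exact: zsp]; lra.
have se0 : 0 < sp * expR (- e) by rewrite mulr_gt0 ?expR_gt0.
exists (`|C| + `|ln c'|) => N.
have := HC N; rewrite lnM ?posrE ?expR_gt0 // expRK => upN.
have loN : ln c' + N%:R * (ln sp - e) <= ln (u N).
  apply: (@le_trans _ _ (ln (c' * (sp * expR (- e)) ^+ N))).
    rewrite lnM ?posrE ?exprn_gt0 // lnXn // lnM ?posrE ?expR_gt0 // expRK.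
    by rewrite mulr_natl.
  rewrite ler_ln ?posrE ?mulr_gt0 ?exprn_gt0 //.
  apply: le_trans (Hc' N); rewrite (ler_wpM2l (ltW c'0)) //.
  by rewrite lerXn2r ?nnegrE ?(ltW zsp) ?(ltW se0) ?normc_ge0.
have := ler_norm C; have := ler_norm (- ln c'); rewrite normrN.
have := normr_ge0 C; have := normr_ge0 (ln c').
by rewrite ler_norml => *; apply/andP; split; lra.
Qed.

End Growth.

(** * Neighbouring members of a sorted list *)

Section ConsecutivePairs.
Context {R : realType}.

(** Replaces indices into the sorted list by order conditions, the form in which net intervals are
    used later. *)
Lemma mem_consecutive (L : seq R) (D : R * R) : sorted <%R L ->
  (D \in zip L (behead L)) <->
  [/\ D.1 \in L, D.2 \in L, D.1 < D.2 & forall h, h \in L -> h <= D.1 \/ D.2 <= h].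
Proof.
move=> sL; have sz : size (zip L (behead L)) = (size L).-1.
  by rewrite size_zip size_behead; apply/minn_idPr; rewrite leq_pred.
have zE i : (i < (size L).-1)%N ->
    nth (0, 0) (zip L (behead L)) i = (nth 0 L i, nth 0 L i.+1).
  by move=> iL; rewrite nth_zip_cond sz iL nth_behead.
split=> [Din|[/(nthP 0)[i iL D1] /(nthP 0)[j jL D2] D12 nin]].
  have := nth_index (0, 0) Din; have := Din; rewrite -index_mem sz.
  set i := index _ _ => iL; rewrite zE // => <- /=.
  have iL1 : (i.+1 < size L)%N by lia.
  have iL0 : (i < size L)%N by lia.
  rewrite !mem_nth // lt_sorted_ltn_nth ?inE // ltnSn; split=> // h /(nthP 0)[k kL <-].
  rewrite !lt_sorted_leq_nth ?inE //; lia.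
have ij : (i < j)%N by rewrite -(lt_sorted_ltn_nth 0 sL) ?inE ?D1 ?D2.
have iL1 : (i.+1 < size L)%N by apply: leq_ltn_trans jL.
have [||] := nin (nth 0 L i.+1); first exact: mem_nth.
  rewrite -D1 lt_sorted_leq_nth ?inE //; lia.
rewrite -D2 lt_sorted_leq_nth ?inE //.
move=> ji; have ji' : j = i.+1 by lia.
have iL' : (i < (size L).-1)%N by lia.
have -> : D = nth (0, 0) (zip L (behead L)) i.
  by rewrite zE // -ji' D1 D2; case: (D).
by rewrite mem_nth // sz.
Qed.

Lemma consecutive_sorted (L : seq R) : sorted <%R L ->
  sorted (fun D E : R * R => D.1 < E.1) (zip L (behead L)).
Proof.
move=> sL; have sz : size (zip L (behead L)) = (size L).-1.
  by rewrite size_zip size_behead; apply/minn_idPr; rewrite leq_pred.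
apply/(sortedP (0 : R, 0 : R)) => i; rewrite sz => iL.
have iL1 : (i.+1 < size L)%N by lia.
by rewrite !nth_zip_cond sz iL (ltnW iL) /= lt_sorted_ltn_nth ?inE // ltnW.
Qed.

End ConsecutivePairs.

(** * Net intervals, their ends and neighbours, in normalised coordinates *)

Section NetIntervals.
Context {R : realType} {m : nat} (rho : R) (d p : 'I_m.+1 -> R).
Context (rho01 : 0 < rho < 1).
Context (d_mono : forall i j : 'I_m.+1, (i < j)%N -> d i < d j).
Context (p_gt0 : forall j, 0 < p j).
Context (d0 : d ord0 = 0) (dm : d ord_max = 1 - rho).

Local Notation word := (simil_word rho d).
Local Notation endpoints := (endpoints rho d).
Local Notation net := (net_intervals rho d).
Local Notation neighbours := (neighbours rho d).
Local Notation subitv := Defs.subitv.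
Local Notation covers s D := (subitv D (word s 0, word s 1)).

Let rho_gt0 : 0 < rho. Proof. by case/andP: rho01. Qed.
Let rhoX_gt0 n : 0 < rho ^+ n. Proof. exact: exprn_gt0. Qed.
Let rhoX_neq0 n : rho ^+ n != 0. Proof. by rewrite gt_eqF. Qed.

Lemma endpointsP n h :
  (h \in endpoints n) <-> exists s (e : bool), size s = n /\ word s e%:R = h.
Proof.
rewrite /endpoints mem_sort mem_undup mem_cat; split.
  case/orP => /mapP[s _ ->]; [exists s, false|exists s, true];
  by rewrite size_tuple.
move=> [s [e [sn <-]]]; apply/orP.
have {sn} : exists t : n.-tuple 'I_m.+1, s = t by exists (tcast sn (in_tuple s)); rewrite val_tcast.
by move=> [t ->]; case: e; [right|left]; apply/mapP; exists t; rewrite ?mem_enum.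
Qed.

Lemma endpoints_sorted n : sorted <%R (endpoints n).
Proof. by rewrite lt_sorted_uniq_le sort_uniq undup_uniq sort_le_sorted. Qed.

(** An end can be continued by an extreme letter: the first map fixes 0 and the last map fixes 1. *)
Lemma endpointsS n h : h \in endpoints n -> h \in endpoints n.+1.
Proof.
move/endpointsP => [s [e [sn <-]]]; apply/endpointsP.
exists (rcons s (if e then ord_max else ord0)), e.
rewrite size_rcons sn simil_word_rcons; split=> //; congr (word s _).
by case: e; rewrite ?dm ?d0 /=; ring.
Qed.

Lemma netP n D : (D \in net n) <->
  [/\ D.1 \in endpoints n, D.2 \in endpoints n, D.1 < D.2 &
      forall h, h \in endpoints n -> h <= D.1 \/ D.2 <= h].
Proof. exact/mem_consecutive/endpoints_sorted. Qed.

Lemma net_lt {n D} : D \in net n -> D.1 < D.2.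
Proof. by move/netP => []. Qed.

Lemma net_left {n D s} : D \in net n -> size s = n -> word s 0 < D.2 -> word s 0 <= D.1.
Proof.
move/netP => [_ _ _ nin] sn sD; have [|//|h] := nin (word s 0).
  by apply/endpointsP; exists s, false.
by rewrite leNgt sD in h.
Qed.

Lemma net_right {n D s} : D \in net n -> size s = n -> D.1 < word s 1 -> D.2 <= word s 1.
Proof.
move/netP => [_ _ _ nin] sn sD; have [|h|//] := nin (word s 1).
  by apply/endpointsP; exists s, true.
by rewrite leNgt sD in h.
Qed.

(** Two net intervals of one level containing the nondegenerate [D] coincide, so the filtered list
    in [parent] has no entry other than [E], and the default of [head] is not reached. *)
Lemma parentE n E D : parent_child rho d n E D -> parent rho d n D = E.
Proof.
move=> [En Dn DE]; rewrite /parent.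
have uniqE E' : E' \in net n -> subitv D E' -> E' = E.
  move=> E'n DE'; have D12 := net_lt Dn.
  case/andP: DE => DE1 DE2; case/andP: DE' => DE1' DE2'.
  move/netP: E'n => [E1' E2' E12' nin']; move/netP: En => [E1 E2 E12 nin].
  rewrite [E']surjective_pairing [E in _ = E]surjective_pairing.
  have := nin _ E1'; have := nin _ E2'; have := nin' _ E1; have := nin' _ E2.
  by move=> ????; congr pair; lra.
have : E \in [seq E' <- net n | subitv D E'] by rewrite mem_filter DE.
have : all (fun E' => E' == E) [seq E' <- net n | subitv D E'].
  by apply/allP => E'; rewrite mem_filter => /andP[DE' E'n]; apply/eqP; apply: uniqE.
by case: [seq _ <- _ | _] => //= E' l /andP[/eqP].
Qed.

Lemma neighboursP n D a : (a \in neighbours n D) <->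
  exists s, [/\ size s = n, covers s D & rho ^- n * (D.1 - word s 0) = a].
Proof.
rewrite /neighbours mem_sort mem_undup; split.
  by move=> /mapP[s]; rewrite mem_filter => /andP[sD _] ->; exists s; rewrite size_tuple.
move=> [s [sn sD <-]].
have {sn} : exists t : n.-tuple 'I_m.+1, s = t by exists (tcast sn (in_tuple s)); rewrite val_tcast.
by move=> [t ts]; subst s; apply/mapP; exists t; rewrite // mem_filter sD mem_enum.
Qed.

Lemma neighbours_sorted n D : sorted <%R (neighbours n D).
Proof. by rewrite lt_sorted_uniq_le sort_uniq undup_uniq sort_le_sorted. Qed.

Lemma neighbours_uniq n D : uniq (neighbours n D).
Proof. by rewrite sort_uniq undup_uniq. Qed.

(** Coordinate with origin at the left end of [E] in which the intervals of words of length n have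
    length 1. *)
Definition rel_pos n (E : R * R) (h : R) : R := rho ^- n * (h - E.1).

Lemma rel_posK n E h : E.1 + rho ^+ n * rel_pos n E h = h.
Proof. by rewrite /rel_pos mulVKf // subrKC. Qed.

Lemma rel_pos_inj n E : injective (rel_pos n E).
Proof. by move=> h h' e; rewrite -(rel_posK n E h) e rel_posK. Qed.

Lemma rel_posV n E u : rel_pos n E (E.1 + rho ^+ n * u) = u.
Proof. by rewrite /rel_pos addrC addKr mulKf. Qed.

Lemma rel_pos_le n E h h' : (rel_pos n E h <= rel_pos n E h') = (h <= h').
Proof. by rewrite /rel_pos ler_pM2l ?invr_gt0 // lerD2r. Qed.

Lemma rel_pos1 n E : rel_pos n E E.1 = 0.
Proof. by rewrite /rel_pos subrr mulr0. Qed.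

Lemma rel_pos2 n E : rel_pos n E E.2 = nlen rho n E.
Proof. by []. Qed.

Lemma rel_pos_word n E s x : size s = n ->
  rel_pos n E (word s x) = x - rho ^- n * (E.1 - word s 0).
Proof.
move=> sn; apply: (mulfI (rhoX_neq0 n)); rewrite mulrBr /rel_pos !mulVKf //.
by rewrite simil_wordE sn; ring.
Qed.

Lemma inner_endpointP n E h : E \in net n -> E.1 < h < E.2 ->
  (h \in endpoints n.+1) <->
  exists a j (e : bool), a \in neighbours n E /\ rel_pos n E h = rho * e%:R + d j - a.
Proof.
move=> En /andP[E1h hE2]; split.
  move/endpointsP => [s [e [sn sh]]]; case/lastP: s sn sh => [//|s j].
  rewrite size_rcons => -[sn] sh.
  exists (rho ^- n * (E.1 - word s 0)), j, e; split.
    apply/neighboursP; exists s; split=> //.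
    move: sh; rewrite simil_word_rcons simil_wordE => sh.
    have /andP[dj0 dj1] := d_bounds rho d d_mono d0 dm j.
    have /andP[r0 r1] := rho01.
    have e01 : 0 <= rho * e%:R + d j <= 1 by case: (e); rewrite /=; lra.
    have s0h : word s 0 <= h.
      by rewrite -sh lerDl mulr_ge0 ?exprn_ge0 ?(ltW r0) //; lra.
    have s1h : h <= word s 1.
      by rewrite -sh [leRHS]simil_wordE lerD2l ler_wpM2l ?exprn_ge0 ?(ltW r0) //; lra.
    apply/andP; split=> /=.
      by apply: (net_left En sn); apply: le_lt_trans hE2.
    by apply: (net_right En sn); apply: lt_le_trans s1h.
  by rewrite -sh simil_word_rcons rel_pos_word.
move=> [a [j [e [/neighboursP[s [sn sE <-]] hE]]]].
apply/endpointsP; exists (rcons s j), e; rewrite size_rcons sn; split=> //.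
by apply: (rel_pos_inj n E); rewrite hE simil_word_rcons rel_pos_word.
Qed.

Lemma childrenP n E D : E \in net n -> (D \in children rho d n E) <->
  [/\ D.1 \in endpoints n.+1, D.2 \in endpoints n.+1,
      subitv D E, D.1 < D.2 &
      forall h, E.1 < h < E.2 -> h \in endpoints n.+1 -> h <= D.1 \/ D.2 <= h].
Proof.
move=> En; rewrite /children mem_filter; split.
  by move=> /andP[DE /netP[? ? ? nin]]; split=> // h _; apply: nin.
move=> [D1 D2 DE D12 nin]; rewrite DE; case/andP: DE => ED1 ED2; apply/netP.
split=> // h hn; case: (ltP E.1 h) => [E1h|hE1]; last by left; apply: le_trans ED1.
case: (ltP h E.2) => [hE2|E2h]; last by right; apply: le_trans E2h.
by apply: nin => //; apply/andP.
Qed.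

Lemma cover_rcons {n E D s j} : parent_child rho d n E D -> size s = n ->
  covers (rcons s j) D -> covers s E.
Proof.
move=> [En Dn /andP[ED1 ED2]] sn /andP[/= s0 s1].
have dj := d_bounds rho d d_mono d0 dm j; have r01 := rho01.
have D12 := net_lt Dn; apply/andP; split => /=.
  apply: (net_left En sn); apply: le_lt_trans (lt_le_trans D12 ED2).
  apply: le_trans s0; rewrite simil_word_rcons word_homo //; lra.
apply: (net_right En sn); apply: le_lt_trans ED1 _; apply: lt_le_trans D12 _.
apply: le_trans s1 _; rewrite simil_word_rcons word_homo //; lra.
Qed.

(** Describes the neighbours of a child by data of [E] in the normalised coordinate, so that the
    description can be moved to another interval. *)
Lemma neighbours_childP n E D a : parent_child rho d n E D ->
  (a \in neighbours n.+1 D) <->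
  exists c j, [/\ c \in neighbours n E,
     rho * a = rel_pos n E D.1 + c - d j,
     d j - c <= rel_pos n E D.1 & rel_pos n E D.2 <= rho + d j - c].
Proof.
move=> pc; split.
  move/neighboursP => [s [sn sD sa]]; case/lastP: s sn sD sa => [//|s j].
  rewrite size_rcons => -[sn] sD sa; have sE := cover_rcons pc sn sD.
  exists (rho ^- n * (E.1 - word s 0)), j; case/andP: sD => /= s0 s1.
  split.
  - by apply/neighboursP; exists s.
  - rewrite -sa simil_word_rcons mulr0 add0r [word s (d j)]simil_wordE sn.
    rewrite /rel_pos exprS; have := rhoX_neq0 n; set q := rho ^+ n => q0.
    by field; rewrite q0 gt_eqF.
  - move: s0; rewrite -(rel_pos_le n E) simil_word_rcons rel_pos_word // mulr0 add0r.
    by [].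
  - by move: s1; rewrite -(rel_pos_le n E) simil_word_rcons rel_pos_word // mulr1.
move=> [c [j [/neighboursP[s [sn sE <-]] aE s0 s1]]].
apply/neighboursP; exists (rcons s j); rewrite size_rcons sn; split=> //.
  apply/andP; split=> /=; rewrite -(rel_pos_le n E) simil_word_rcons rel_pos_word //.
    by rewrite mulr0 add0r.
  by rewrite mulr1.
apply: (mulfI (lt0r_neq0 rho_gt0)); rewrite aE.
rewrite simil_word_rcons mulr0 add0r [word s (d j)]simil_wordE sn.
rewrite /rel_pos exprS; have := rhoX_neq0 n; set q := rho ^+ n => q0.
by field; rewrite q0 gt_eqF.
Qed.


(** * Transfer between intervals of equal length and neighbours; transition matrices do not depend
    on the realising pair *)

Definition transfer n E n' (E' : R * R) h := E'.1 + rho ^+ n' * rel_pos n E h.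

Definition transfer_itv n E n' E' (D : R * R) :=
  (transfer n E n' E' D.1, transfer n E n' E' D.2).

Lemma rel_pos_transfer n E n' E' h :
  rel_pos n' E' (transfer n E n' E' h) = rel_pos n E h.
Proof. exact: rel_posV. Qed.

Lemma transferK n E n' E' : cancel (transfer n E n' E') (transfer n' E' n E).
Proof. by move=> h; rewrite {1}/transfer rel_pos_transfer rel_posK. Qed.

Lemma transfer_itvK n E n' E' :
  cancel (transfer_itv n E n' E') (transfer_itv n' E' n E).
Proof. by move=> [a b]; rewrite /transfer_itv !transferK. Qed.

(** Normalised length and neighbours fix the endpoints of the next level inside an interval, hence
    its whole subdivision. *)
Definition same_type n E n' E' :=
  [/\ E \in net n, E' \in net n', nlen rho n E = nlen rho n' E' &
      neighbours n E = neighbours n' E'].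

Lemma same_type_sym {n E n' E'} : same_type n E n' E' -> same_type n' E' n E.
Proof. by case. Qed.

Lemma transfer1 {n E n' E'} : transfer n E n' E' E.1 = E'.1.
Proof. by rewrite /transfer rel_pos1 mulr0 addr0. Qed.

Lemma transfer2 {n E n' E'} : same_type n E n' E' -> transfer n E n' E' E.2 = E'.2.
Proof. by case=> _ _ e _; rewrite /transfer rel_pos2 e -rel_pos2 rel_posK. Qed.

Lemma transfer_le n E n' E' h h' :
  (transfer n E n' E' h <= transfer n E n' E' h') = (h <= h').
Proof. by rewrite /transfer lerD2l ler_pM2l // rel_pos_le. Qed.

Lemma transfer_lt n E n' E' h h' :
  (transfer n E n' E' h < transfer n E n' E' h') = (h < h').
Proof. by rewrite !ltNge transfer_le. Qed.

Lemma endpoint_transfer {n E n' E' h} : same_type n E n' E' ->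
  E.1 < h < E.2 -> h \in endpoints n.+1 -> transfer n E n' E' h \in endpoints n'.+1.
Proof.
move=> st hE; have [En En' _ nb] := st.
move/(inner_endpointP _ _ _ En hE) => [a [j [e [aE hj]]]].
apply/(inner_endpointP _ _ _ En').
  by rewrite -(@transfer1 n E n' E') -(transfer2 st) !transfer_lt.
by exists a, j, e; rewrite -nb rel_pos_transfer.
Qed.

Lemma endpoint_transfer_le {n E n' E' h} : same_type n E n' E' ->
  E.1 <= h <= E.2 -> h \in endpoints n.+1 -> transfer n E n' E' h \in endpoints n'.+1.
Proof.
move=> st /andP[E1h hE2] hn; have [_ /netP[E1 E2 _ _] _ _] := st.
move: E1h; rewrite le_eqVlt => /predU1P[<-|E1h]; first by rewrite transfer1 endpointsS.
move: hE2; rewrite le_eqVlt => /predU1P[->|hE2]; first by rewrite (transfer2 st) endpointsS.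
by apply: (endpoint_transfer st) => //; apply/andP.
Qed.

Lemma child_transfer {n E n' E' D} : same_type n E n' E' ->
  D \in children rho d n E -> transfer_itv n E n' E' D \in children rho d n' E'.
Proof.
move=> st; have [En En' _ nb] := st.
move/(childrenP _ _ _ En) => [D1 D2 /andP[ED1 ED2] D12 nin].
apply/(childrenP _ _ _ En'); split=> /=.
- by apply: (endpoint_transfer_le st) => //; rewrite ED1 (le_trans (ltW D12)).
- by apply: (endpoint_transfer_le st) => //; rewrite ED2 andbT (le_trans _ (ltW D12)).
- apply/andP; split=> /=.
    by rewrite -(@transfer1 n E n' E') transfer_le.
  by rewrite -(transfer2 st) transfer_le.
- by rewrite transfer_lt.
move=> h hE hn; rewrite -(transferK n' E' n E h) !transfer_le; apply: nin.
  by rewrite -(@transfer1 n' E' n E) -(transfer2 (same_type_sym st)) !transfer_lt.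
exact: (endpoint_transfer (same_type_sym st)).
Qed.

Lemma children_sorted n E :
  sorted (fun D D' : R * R => D.1 < D'.1) (children rho d n E).
Proof.
apply: sorted_filter; last exact/consecutive_sorted/endpoints_sorted.
by move=> ???; apply: lt_trans.
Qed.

(** The transfer maps in both directions are increasing and mutually inverse, so even the order of
    the lists agrees; this makes positions comparable between different intervals. *)
Lemma children_transfer n E n' E' : same_type n E n' E' ->
  children rho d n' E' = [seq transfer_itv n E n' E' D | D <- children rho d n E].
Proof.
move=> st; apply: (@irr_sorted_eq _ (fun D D' : R * R => D.1 < D'.1)).
- by move=> ???; apply: lt_trans.
- by move=> D; apply: ltxx.
- exact: children_sorted.
- rewrite sorted_map; apply: sub_sorted (children_sorted n E) => D D'.
  by rewrite /= transfer_lt.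
move=> D; apply/idP/mapP => [Dn|[D' D'n ->]]; last exact: child_transfer.
exists (transfer_itv n' E' n E D); last by rewrite transfer_itvK.
exact: (child_transfer (same_type_sym st)).
Qed.

Lemma mem_children n E D : E \in net n -> D \in children rho d n E ->
  parent_child rho d n E D.
Proof. by move=> En; rewrite mem_filter => /andP[DE Dn]; split. Qed.

Lemma nlen_child n E D : nlen rho n.+1 D = rho^-1 * (rel_pos n E D.2 - rel_pos n E D.1).
Proof.
by rewrite /nlen /rel_pos exprS invfM -!mulrA -mulrBr; congr (_ * (_ * _)); ring.
Qed.

Lemma nlen_transfer n E n' E' D :
  nlen rho n'.+1 (transfer_itv n E n' E' D) = nlen rho n.+1 D.
Proof. by rewrite (nlen_child n E) (nlen_child n' E') !rel_pos_transfer. Qed.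

Lemma neighbours_transfer n E n' E' D : same_type n E n' E' ->
  D \in children rho d n E ->
  neighbours n'.+1 (transfer_itv n E n' E' D) = neighbours n.+1 D.
Proof.
move=> st Dn; have [En En' _ nb] := st.
apply: lt_sorted_eq => [||a]; try exact: neighbours_sorted.
have pc := mem_children _ _ _ En Dn.
have pc' := mem_children _ _ _ En' (child_transfer st Dn).
have rD1 : rel_pos n' E' (transfer_itv n E n' E' D).1 = rel_pos n E D.1 by exact: rel_pos_transfer.
have rD2 : rel_pos n' E' (transfer_itv n E n' E' D).2 = rel_pos n E D.2 by exact: rel_pos_transfer.
apply/idP/idP => [/(neighbours_childP _ _ _ _ pc')|/(neighbours_childP _ _ _ _ pc)] H.
  by apply/(neighbours_childP _ _ _ _ pc); rewrite nb -rD1 -rD2.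
by apply/(neighbours_childP _ _ _ _ pc'); rewrite -nb rD1 rD2.
Qed.

(* The position in a characteristic vector pins down which child is meant: the
   children of E' are the images of those of E under an affine map preserving
   order, normalised length and neighbours. *)
Lemma rel_pos_characteristic n E D n' E' D' :
  parent_child rho d n E D -> parent_child rho d n' E' D' ->
  characteristic rho d n E = characteristic rho d n' E' ->
  characteristic rho d n.+1 D = characteristic rho d n'.+1 D' ->
  rel_pos n E D.1 = rel_pos n' E' D'.1.
Proof.
move=> pc pc' [lE nE _] [lD nD]; rewrite /position (parentE _ _ _ pc) (parentE _ _ _ pc').
have [En Dn DE] := pc; have [En' Dn' DE'] := pc'.
have st : same_type n E n' E' by split.
set P := fun X => _ && _; set P' := fun X => (nlen rho n'.+1 X == _) && _.
have chD : D \in children rho d n E by rewrite mem_filter DE.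
have chD' : D' \in children rho d n' E' by rewrite mem_filter DE'.
(* Siblings with the same length and neighbours correspond in order, so equal indices force [D'] to
   be the image of [D]. *)
have -> : [seq X <- children rho d n' E' | P' X] =
    [seq transfer_itv n E n' E' X | X <- [seq X <- children rho d n E | P X]].
  rewrite (children_transfer _ _ _ _ st) filter_map; congr map.
  apply: eq_in_filter => X Xn; rewrite /P' /P /= nlen_transfer neighbours_transfer //.
  by rewrite lD nD.
move=> [idx].
have DP : D \in [seq X <- children rho d n E | P X] by rewrite mem_filter /P !eqxx.
have : D' = transfer_itv n E n' E' D; last by move=> ->; rewrite rel_pos_transfer.
have D'P : D' \in [seq transfer_itv n E n' E' X | X <- [seq X <- children rho d n E | P X]].
  rewrite -(transfer_itvK n' E' n E D') map_f // mem_filter.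
  rewrite (child_transfer (same_type_sym st)) // andbT /P nlen_transfer.
  by rewrite (neighbours_transfer _ _ _ _ _ (same_type_sym st)) // lD nD !eqxx.
rewrite -(nth_index (0, 0) D'P) -idx (nth_map (0, 0)) ?index_mem //.
by rewrite nth_index.
Qed.

(** By [rel_pos_characteristic] every realisation of the two characteristic vectors yields the same
    equation for [d l], and [d] is injective. So [pick] finds the only solution, if any, and the
    entry is a sum of indicators for the given pair. *)
Lemma prim_transitionE n E D j k : parent_child rho d n E D ->
  prim_transition rho d p (characteristic rho d n E) (characteristic rho d n.+1 D) j k =
  \sum_(l < m.+1) (p ord0)^-1 * p l *
    (d l == rel_pos n E D.1 + (neighbours n E)`_j - rho * (neighbours n.+1 D)`_k)%:R.
Proof.
move=> pc; rewrite mxE /=.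
set a := _`_j; set b := _`_k.
have eqE n' (E' D' : R * R) l : (E'.1 - rho ^+ n' * a + rho ^+ n' * d l = D'.1 - rho ^+ n'.+1 * b)
    <-> d l = rel_pos n' E' D'.1 + a - rho * b.
  rewrite /rel_pos exprS; have := rhoX_neq0 n'; set q := rho ^+ n' => q0; split=> e.
    apply: (mulfI q0); rewrite mulrBr mulrDr mulVKf //.
    have := e; move/eqP; rewrite -subr_eq0 => /eqP e'.
    by apply/eqP; rewrite -subr_eq0 -e'; apply/eqP; ring.
  by rewrite e mulrBr mulrDr mulVKf //; ring.
have PE l : `[< exists n0 E0 D0, [/\ parent_child rho d n0 E0 D0,
     characteristic rho d n0 E0 = characteristic rho d n E,
     characteristic rho d n0.+1 D0 = characteristic rho d n.+1 D &
     E0.1 - rho ^+ n0 * a + rho ^+ n0 * d l = D0.1 - rho ^+ n0.+1 * b]>] =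
   (d l == rel_pos n E D.1 + a - rho * b).
  apply/asboolP/eqP => [[n' [E' [D' [pc' cE cD /eqE ->]]]]|e].
    by rewrite (rel_pos_characteristic _ _ _ _ _ _ pc' pc).
  by exists n, E, D; split=> //; apply/eqE.
rewrite (eq_pick PE); case: pickP => [l /eqP dl|no].
  rewrite (bigD1 l) //= -dl eqxx mulr1 big1 ?addr0 // => i il.
  by rewrite (inj_eq (d_inj d d_mono)) (negPf il) mulr0.
by rewrite big1 // => l _; rewrite no mulr0.
Qed.

Lemma prim_transition_ge0 alpha beta j k :
  0 <= prim_transition rho d p alpha beta j k.
Proof.
rewrite mxE; case: pickP => [l _|_ //].
by rewrite mulr_ge0 ?invr_ge0 // ltW.
Qed.

Lemma transition_ge0 alpha w beta j k : 0 <= transition rho d p alpha w beta j k.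
Proof.
elim: w alpha j => [|a w IH] alpha j /=; first exact: prim_transition_ge0.
by rewrite mxE sumr_ge0 // => i _; rewrite mulr_ge0 ?prim_transition_ge0.
Qed.

(** * Covering weights sorted by neighbours, and their multiplication by transition matrices *)

Definition cover_vector alpha n D : 'rV[R]_(size (cv_nbs alpha)) :=
  \row_i word_sum p n (fun s =>
    covers s D && (rho ^- n * (D.1 - word s 0) == (cv_nbs alpha)`_i)).

(** A word of length n + 1 with the same offset as a word covering [D] has the same interval, so the
    matching offset alone implies covering. *)
Lemma cover_child {n E D s l a} : parent_child rho d n E D -> size s = n ->
  covers s E -> a \in neighbours n.+1 D ->
  covers (rcons s l) D && (rho ^- n.+1 * (D.1 - word (rcons s l) 0) == a) =
  (d l == rel_pos n E D.1 + rho ^- n * (E.1 - word s 0) - rho * a).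
Proof.
move=> pc sn sE aD.
have -> : (rho ^- n.+1 * (D.1 - word (rcons s l) 0) == a) =
  (d l == rel_pos n E D.1 + rho ^- n * (E.1 - word s 0) - rho * a).
  rewrite -(inj_eq (mulfI (lt0r_neq0 rho_gt0))).
  have -> : rho * (rho ^- n.+1 * (D.1 - word (rcons s l) 0)) =
      rel_pos n E D.1 + rho ^- n * (E.1 - word s 0) - d l.
    rewrite simil_word_rcons mulr0 add0r [word s (d l)]simil_wordE sn.
    rewrite /rel_pos exprS; have := rhoX_neq0 n; set q := rho ^+ n => q0.
    by field; rewrite q0 gt_eqF.
  by rewrite subr_eq [RHS]eq_sym subr_eq [rho * a + _]addrC.
apply: andb_idl => /eqP e; case/neighboursP: aD => t [tn tD ta].
have e0 : word (rcons s l) 0 = word t 0.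
  apply: (rel_pos_inj n E); rewrite simil_word_rcons rel_pos_word // mulr0 add0r e.
  rewrite -ta exprS /rel_pos; have := rhoX_neq0 n; set q := rho ^+ n => q0.
  by field; rewrite q0 gt_eqF.
have e1 : word (rcons s l) 1 = word t 1.
  by rewrite [LHS]simil_wordE [RHS]simil_wordE e0 size_rcons sn tn.
by rewrite e0 e1.
Qed.

(** A word covering [D] is a word covering [E] followed by a letter, whose weight the transition
    matrix records; the scalar [p ord0] undoes the normalisation of the matrix. *)
Lemma cover_vector_step n E D alpha beta : parent_child rho d n E D ->
  characteristic rho d n E = alpha -> characteristic rho d n.+1 D = beta ->
  cover_vector beta n.+1 D =
  p ord0 *: (cover_vector alpha n E *m prim_transition rho d p alpha beta).
Proof.
move=> pc <- <-; apply/rowP => k; rewrite !mxE word_sumS mulr_sumr.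
under [RHS]eq_bigr => i _ do
  rewrite prim_transitionE // mxE /word_sum big_mkcond /= mulr_suml mulr_sumr.
rewrite exchange_big /=; apply: eq_bigr => s _.
have p0 := lt0r_neq0 (p_gt0 ord0).
have aD : (neighbours n.+1 D)`_k \in neighbours n.+1 D by rewrite mem_nth.
have [sE|sE] := boolP (covers s E); last first.
  rewrite !big1 ?mulr0 // => [i _|j /andP[sjD _]]; first by rewrite /= mul0r mulr0.
  by move: sE; rewrite (cover_rcons pc (size_tuple s) sjD).
have cE : rho ^- n * (E.1 - word s 0) \in neighbours n E.
  by apply/neighboursP; exists s; rewrite size_tuple.
have iE := cE; rewrite -index_mem in iE.
(* The word [s] contributes only to the coordinate of its own offset. *)
rewrite (bigD1 (Ordinal iE)) //= nth_index // eqxx [X in _ + X]big1 ?addr0.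
  rewrite mulrCA; congr (_ * _); rewrite big_mkcond mulr_sumr; apply: eq_bigr => l _.
  rewrite (cover_child pc (size_tuple s) sE aD).
  by case: eqP => _; rewrite ?mulr1 ?mulr0 // mulVKf.
move=> i ii; case: eqP => [e|_]; last by rewrite mul0r mulr0.
move: ii; rewrite -(inj_eq val_inj) /= e index_uniq ?eqxx //; exact: neighbours_uniq.
Qed.

Lemma word_sum_gt0 n s (b : pred (seq 'I_m.+1)) : size s = n -> b s -> 0 < word_sum p n b.
Proof.
move=> sn bs; rewrite /word_sum (bigD1 (tcast sn (in_tuple s))) /= ?val_tcast //.
by rewrite ltr_pwDl ?word_weight_gt0 // sumr_ge0 // => t _; rewrite ltW ?word_weight_gt0.
Qed.

Lemma cover_vector_gt0 n D i : 0 < cover_vector (characteristic rho d n D) n D 0 i.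
Proof.
rewrite mxE /=; have : (neighbours n D)`_i \in neighbours n D by rewrite mem_nth.
by move/neighboursP => [s [sn sD e]]; apply: (word_sum_gt0 _ s _ sn); rewrite sD e eqxx.
Qed.

Lemma cover_vector_sum n D :
  \sum_i cover_vector (characteristic rho d n D) n D 0 i =
  word_sum p n (fun s => covers s D).
Proof.
under eq_bigr => i _ do rewrite mxE /word_sum big_mkcond /=.
rewrite exchange_big /= /word_sum [RHS]big_mkcond /=; apply: eq_bigr => s _.
case: ifPn => sD; last by rewrite big1.
have cE : rho ^- n * (D.1 - word s 0) \in neighbours n D.
  by apply/neighboursP; exists s; rewrite size_tuple.
have iE := cE; rewrite -index_mem in iE.
rewrite (bigD1 (Ordinal iE)) //= nth_index // eqxx big1 ?addr0 // => i ii.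
case: eqP => // e; move: ii; rewrite -(inj_eq val_inj) /= e index_uniq ?eqxx //.
exact: neighbours_uniq.
Qed.

(** No end of a word interval of level n is interior to [D], so an interval that contains [x] and
    reaches beyond it to the right contains all of [D]. *)
Lemma cover_weight_left n D x : D \in net n -> D.1 <= x < D.2 ->
  word_sum p n (fun s => covers s D) = cover_weight rho d p true n x.
Proof.
move=> Dn /andP[D1 D2]; apply: eq_bigl => s; apply/andP/andP => /= -[s0 s1].
  by split; [apply: le_trans D1|apply: lt_le_trans s1].
by split; [apply: (net_left Dn (size_tuple s)); apply: le_lt_trans D2|
           apply: (net_right Dn (size_tuple s)); apply: le_lt_trans s1].
Qed.

Lemma cover_weight_right n D x : D \in net n -> D.1 < x <= D.2 ->
  word_sum p n (fun s => covers s D) = cover_weight rho d p false n x.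
Proof.
move=> Dn /andP[D1 D2]; apply: eq_bigl => s; apply/andP/andP => /= -[s0 s1].
  by split; [apply: le_lt_trans D1|apply: le_trans s1].
by split; [apply: (net_left Dn (size_tuple s)); apply: lt_le_trans D2|
           apply: (net_right Dn (size_tuple s)); apply: lt_le_trans s1].
Qed.

Lemma cover_vector_path (Delta : nat -> R * R) w n alpha beta :
  (forall n, parent_child rho d n (Delta n) (Delta n.+1)) ->
  (forall i, (i <= (size w).+1)%N ->
     characteristic rho d (n + i) (Delta (n + i)%N) = nth alpha (alpha :: rcons w beta) i) ->
  cover_vector beta (n + (size w).+1) (Delta (n + (size w).+1)%N) =
  p ord0 ^+ (size w).+1 *: (cover_vector alpha n (Delta n) *m transition rho d p alpha w beta).
Proof.
move=> pc; elim: w n alpha => [|a w IH] n alpha char.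
  rewrite /= addn1 expr1; apply: cover_vector_step => //.
    by have := char 0 isT; rewrite addn0.
  by have := char 1 isT; rewrite addn1.
rewrite /= addnS -addSn (IH n.+1 a).
  rewrite (cover_vector_step n (Delta n) (Delta n.+1) alpha a) //.
  - by rewrite -scalemxAl scalerA mulmxA [in RHS]exprSr.
  - by have := char 0 isT; rewrite addn0.
  - by have := char 1 isT; rewrite addn1.
(* The index stays within the list, so both defaults of [nth] give the same letter. *)
move=> i iw; rewrite addSn -addnS char //=; apply: set_nth_default.
by rewrite /= size_rcons.
Qed.

End NetIntervals.

Lemma seq_pos_lb {R : realType} (s : seq R) : (forall y, y \in s -> 0 < y) ->
  exists2 c, 0 < c & forall y, y \in s -> c <= y.
Proof.
elim: s => [|y s IH] s0; first by exists 1.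
have [|c c0 cs] := IH; first by move=> z zs; apply: s0; rewrite inE zs orbT.
exists (Num.min y c); first by rewrite lt_min c0 s0 ?mem_head.
by move=> z; rewrite inE ge_min => /predU1P[->|/cs ->]; rewrite ?lexx ?orbT.
Qed.

(** * The self-similar measure: support, covering by the images, mass of balls *)

Section SelfSimilarMeasure.
Context {R : realType} {m : nat} (rho : R) (d p : 'I_m.+1 -> R).
Context (mu : probability (measurableTypeR R) R).
Context (rho01 : 0 < rho < 1).
Context (d_mono : forall i j : 'I_m.+1, (i < j)%N -> d i < d j).
Context (p_gt0 : forall j, 0 < p j) (p_sum1 : \sum_(j < m.+1) p j = 1).
Context (self_sim : self_similar rho d p mu).
Context (supp : measure_support mu = `[0, 1]%classic).

Local Notation word := (simil_word rho d).

Let rho_gt0 : 0 < rho. Proof. by case/andP: rho01. Qed.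

Definition mass (A : set (measurableTypeR R)) : R := fine (mu A).

Lemma massE A : measurable A -> mu A = (mass A)%:E.
Proof. by move=> mA; rewrite fineK // fin_num_measure. Qed.

Lemma mass_ge0 A : 0 <= mass A.
Proof. exact/fine_ge0/measure_ge0. Qed.

Lemma mass_le A B : measurable A -> measurable B -> A `<=` B -> mass A <= mass B.
Proof.
by move=> mA mB AB; rewrite -lee_fin -!massE // le_measure ?inE.
Qed.

Lemma mass_le1 A : measurable A -> mass A <= 1.
Proof. by move=> mA; rewrite -lee_fin -massE // probability_le1. Qed.

Lemma mass_setC A : measurable A -> mass (~` A) = 1 - mass A.
Proof.
move=> mA; apply: EFin_inj; rewrite -massE; last exact: measurableC.
by rewrite probability_setC // massE.
Qed.

Lemma continuous_simil j : continuous (simil rho d j : R -> R).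
Proof.
move=> y; apply: (@cvgD _ R^o); last exact: cvg_cst.
by apply: (@cvgM R); [exact: cvg_cst|exact: cvg_id].
Qed.

Lemma measurable_simil j (A : set (measurableTypeR R)) :
  measurable A -> measurable (simil rho d j @^-1` A).
Proof.
move=> mA; rewrite -[X in measurable X]setTI.
have mf : measurable_fun setT (simil rho d j : measurableTypeR R -> measurableTypeR R).
  apply:  measurable_realfun.continuous_measurable_fun; exact: continuous_simil.
exact: mf.
Qed.

Lemma mass_simil A : measurable A ->
  mass A = \sum_(j < m.+1) p j * mass (simil rho d j @^-1` A).
Proof.
move=> mA; apply: EFin_inj; rewrite -massE // self_sim // -sumEFin.
by apply: eq_bigr => j _; rewrite massE //; apply: measurable_simil.
Qed.

Lemma measurable_word s (A : set (measurableTypeR R)) :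
  measurable A -> measurable (word s @^-1` A).
Proof.
elim: s A => [//|j s IH] A mA.
by apply: (IH (simil rho d j @^-1` A)); apply: measurable_simil.
Qed.

Lemma mass_word n A : measurable A ->
  mass A = \sum_(s : n.-tuple 'I_m.+1) word_weight p s * mass (word s @^-1` A).
Proof.
move=> mA; elim: n => [|n ->].
  rewrite (big_pred1 [tuple]) => [|t]; last by rewrite (tuple0 t) /= eqxx.
  by rewrite /word_weight big_nil mul1r.
rewrite (big_tuple_rcons _ _ (fun s => word_weight p s * mass (word s @^-1` A))).
apply: eq_bigr => s _; rewrite mass_simil; last exact: measurable_word.
rewrite mulr_sumr; apply: eq_bigr => j _; rewrite word_weight_rcons mulrA.
by congr (_ * mass _); apply/seteqP; split => y; rewrite /preimage /= simil_word_rcons.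
Qed.

(** The support is stable under each map: the preimage of a neighbourhood has positive mass, of
    which self-similarity passes on the fraction [p j]. This is applied to the points 0 and 1. *)
Lemma simil_bounds j : 0 <= d j /\ d j + rho <= 1.
Proof.
have stable (y : R) : 0 <= y <= 1 -> 0 <= rho * y + d j <= 1.
  have sE (z : R) : (0 <= z <= 1) <-> measure_support mu z.
    by rewrite supp /= in_itv.
  move=> /sE sy; apply/sE => U oU Uy.
  have mU : measurable (U : set (measurableTypeR R)) by exact: measurable_realfun.open_measurable.
  have oU' : open (simil rho d j @^-1` U).
    by apply: open_comp oU => z _; apply: continuous_simil.
  have := sy _ oU' Uy; rewrite !massE //; last exact: measurable_simil.
  rewrite !lte_fin => H; rewrite mass_simil // (bigD1 j) //= ltr_pwDl ?mulr_gt0 //.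
  by apply: sumr_ge0 => i _; rewrite mulr_ge0 ?mass_ge0 // ltW.
by have := stable 0; have := stable 1; rewrite !lexx !ler01 => /(_ isT) ? /(_ isT) ?; split; lra.
Qed.

(* Each S_j pulls the complement of [-t, 1 + t] back into the complement of
   [-t/rho, 1 + t/rho]. *)
Lemma mass_outside (t : R) : 0 < t -> mass (~` `[- t, 1 + t]%classic) = 0.
Proof.
move=> t0; pose A (u : R) : set (measurableTypeR R) := ~` `[- u, 1 + u]%classic.
have mA (u : R) : measurable (A u) by apply: measurableC; apply: measurable_itv.
have AE (u : R) (y : R) : A u y <-> ~~ (- u <= y <= 1 + u) by rewrite /A /= in_itv /=; split=> [/negP|/negP].
have Ale (u v : R) : u <= v -> A v `<=` A u.
  by move=> uv y /AE H; apply/AE; apply: contra H => /andP[? ?]; apply/andP; split; lra.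
have step (u : R) : 0 < u -> mass (A u) <= mass (A (u / rho)).
  move=> u0; rewrite mass_simil // -[leRHS]mul1r -p_sum1 mulr_suml.
  apply: ler_sum => j _; apply: (ler_wpM2l (ltW (p_gt0 j))); apply: mass_le => //.
    exact: measurable_simil.
  move=> y /AE H; apply/AE; apply: contra H => /andP[y1 y2].
  have [d0 d1] := simil_bounds j; have r0 := rho_gt0.
  have uy : - u <= rho * y by rewrite mulrC -ler_pdivrMr // mulNr.
  have yu : rho * y <= rho + u.
    by rewrite mulrC -ler_pdivlMr // mulrDl divff ?gt_eqF.
  by rewrite /simil; apply/andP; split; lra.
have stepn k : mass (A t) <= mass (A (t / rho ^+ k)).
  elim: k => [|k IH]; first by rewrite expr0 divr1.
  apply: le_trans IH _; rewrite exprSr invfM mulrA; apply: step.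
  by rewrite divr_gt0 ?exprn_gt0.
have stepN (n : nat) : (mu (A t) <= mu (A n%:R))%E.
  rewrite !massE // lee_fin.
  (* Enough iterations for t / rho^k to exceed n, by the Bernoulli estimate [bern]. *)
  pose k := Num.bound (n%:R / (t * (rho^-1 - 1))).
  have r1 : 0 < rho^-1 - 1 by rewrite subr_gt0 invf_gt1 //; case/andP: rho01.
  have tr : 0 < t * (rho^-1 - 1) by rewrite mulr_gt0.
  apply: le_trans (stepn k) _; apply: mass_le => //; apply: Ale.
  have nk : n%:R < k%:R * (t * (rho^-1 - 1)).
    by rewrite -ltr_pdivrMr // archi_boundP // divr_ge0 // ltW.
  apply: le_trans (ltW nk) _; rewrite mulrCA ler_pM2l //.
  have bern (l : nat) : l%:R * (rho^-1 - 1) <= (rho ^+ l)^-1.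
    elim: l => [|l IH]; first by rewrite mul0r expr0 invr1.
    have l1 : 1 <= (rho ^+ l)^-1.
      by rewrite invf_ge1 ?exprn_gt0 // exprn_ile1 // ltW //; case/andP: rho01.
    rewrite exprSr invfM -natr1 mulrDl mul1r.
    apply: (@le_trans _ _ ((rho ^+ l)^-1 + (rho ^+ l)^-1 * (rho^-1 - 1))).
      by rewrite lerD // ler_peMl // ltW.
    by rewrite mulrBr mulr1 addrC subrK mulrC.
  exact: bern.
have cap0 : \bigcap_n A n%:R = set0.
  apply/seteqP; split => // y H.
  have /AE/negP := H (Num.bound `|y : R|) I; apply.
  have := archi_boundP (normr_ge0 (y : R)); rewrite ltr_norml => /andP[? ?].
  by apply/andP; split; lra.
(* The sets decrease to the empty set, so their masses tend to 0 while each bounds the mass of [A t]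
   from above. *)
have cv : mu \o (fun n => A n%:R) @ \oo --> mu (\bigcap_n A n%:R).
  apply: nonincreasing_cvg_mu => //.
  - exact: (le_lt_trans (probability_le1 mu (mA 0)) (ltry 1)).
  - by rewrite cap0.
  - by move=> n k nk; apply/subsetPset; apply: Ale; rewrite ler_nat.
have : (mu (A t) <= mu (\bigcap_n A n%:R))%E.
  by apply: cvge_ge cv; apply: nearW => n /=; apply: stepN.
rewrite cap0 measure0 massE // lee_fin => H.
by apply/eqP; rewrite eq_le H mass_ge0.
Qed.

Lemma mass_disjoint (a b : R) : b < 0 \/ 1 < a -> mass `[a, b]%classic = 0.
Proof.
move=> ab; have [t t0 abt] : exists2 t : R, 0 < t & b < - t \/ 1 + t < a.
  case: ab => h; first by exists (- b / 2); [lra|left; lra].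
  by exists ((a - 1) / 2); [lra|right; lra].
apply/eqP; rewrite eq_le mass_ge0 andbT -(mass_outside _ t0).
apply: mass_le; try exact: measurable_itv.
  by apply: measurableC; apply: measurable_itv.
move=> y /=; rewrite !in_itv /= => /andP[? ?]; apply/negP; rewrite negb_and -!ltNge.
by apply/orP; case: abt => ?; [left|right]; lra.
Qed.

Lemma mass_unit (t : R) : 0 < t -> mass `[- t, 1 + t]%classic = 1.
Proof.
move=> /mass_outside; rewrite mass_setC; last exact: measurable_itv.
by move/eqP; rewrite subr_eq0 => /eqP.
Qed.

Lemma simil_preimage_itv j a b :
  simil rho d j @^-1` `[a, b]%classic = `[(a - d j) / rho, (b - d j) / rho]%classic.
Proof.
apply/seteqP; split => y; rewrite /preimage /= !in_itv /= /simil;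
  by rewrite ler_pdivrMr // ler_pdivlMr // lerBlDr lerBrDr [y * _]mulrC.
Qed.

(** A point outside the finitely many closed images has a small interval around it that misses them
    all; self-similarity gives it mass 0, so the point is not in the support. *)
Lemma simil_covering (y : R) : 0 <= y <= 1 -> exists j, d j <= y <= d j + rho.
Proof.
move=> y01; apply: contrapT => nex.
pose e j := if y < d j then d j - y else y - (d j + rho).
have e0 j : 0 < e j.
  rewrite /e; case: (ltP y (d j)) => [yd|dy]; first by rewrite subr_gt0.
  by rewrite subr_gt0 ltNge; apply/negP => yd; apply: nex; exists j; rewrite dy yd.
have [|c c0 ce] := seq_pos_lb (codom e); first by move=> _ /codomP[j ->].
have {}ce j : c <= e j by apply: ce; apply: codom_f.
have : measure_support mu y by rewrite supp /= in_itv.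
have yball : ball y (c / 2) y by apply: ballxx; rewrite divr_gt0.
move=> /(_ _ (ball_open y _) yball).
have mB : measurable (`[y - c / 2, y + c / 2]%classic : set (measurableTypeR R)).
  exact: measurable_itv.
have : mass `[y - c / 2, y + c / 2]%classic = 0.
  rewrite mass_simil // big1 // => j _; rewrite simil_preimage_itv mass_disjoint ?mulr0 //.
  have := ce j; rewrite /e; have r0 := rho_gt0; case: (ltP y (d j)) => [dy|dy] cj.
    by left; rewrite ltr_pdivrMr // mul0r; lra.
  by right; rewrite ltr_pdivlMr // mul1r; lra.
have mBall : measurable (ball y (c / 2) : set (measurableTypeR R)).
  by apply: measurable_realfun.open_measurable; apply: ball_open; rewrite divr_gt0.
move=> m0; rewrite massE // lte_fin ltNge -m0; apply/negP; rewrite negbK.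
apply: mass_le => // z; rewrite /ball /= ltr_norml in_itv /= => /andP[? ?].
by apply/andP; split; lra.
Qed.

Lemma d_first : d ord0 = 0.
Proof.
have [|j /andP[j0 _]] := simil_covering 0; first by rewrite lexx ler01.
have [i0 _] := simil_bounds ord0.
by have := d_homo d d_mono ord0 j isT; lra.
Qed.

Lemma d_last : d ord_max = 1 - rho.
Proof.
have [|j /andP[_ j1]] := simil_covering 1; first by rewrite lexx ler01.
have [_ i1] := simil_bounds ord_max.
by have := d_homo d d_mono j ord_max; rewrite -ltnS ltn_ord => /(_ isT); lra.
Qed.

Lemma mass_ball_ge e n x :
  cover_weight rho d p e n x <= mass `[x - 2 * rho ^+ n, x + 2 * rho ^+ n]%classic.
Proof.
rewrite [leRHS](mass_word n); last exact: measurable_itv.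
rewrite /cover_weight /word_sum big_mkcond; apply: ler_sum => s _.
have w0 := word_weight_gt0 p p_gt0 s.
case: ifP => [sx|_]; last by rewrite mulr_ge0 ?mass_ge0 // ltW.
(* The interval [-1, 2] stands in for [0, 1], as [mass_unit] gives full mass to proper
   enlargements. *)
rewrite ler_peMr ?(ltW w0) // -[leLHS](mass_unit _ ltr01).
apply: mass_le; [exact: measurable_itv|by apply: measurable_word; apply: measurable_itv|].
have {sx} /andP[s0 s1] : word s 0 <= x <= word s 1.
  by move: sx; rewrite /one_sided; case: e => /andP[? ?]; apply/andP; split; rewrite // ltW.
have q0 : 0 < rho ^+ n by rewrite exprn_gt0.
have aux (y : R) : -1 <= y <= 1 + 1 ->
    x - 2 * rho ^+ n <= word s y <= x + 2 * rho ^+ n.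
  move=> /andP[y0 y1]; move: s0 s1.
  rewrite simil_word1 [word s y]simil_wordE size_tuple => s0 s1.
  have qy : - rho ^+ n <= rho ^+ n * y by rewrite -mulrN1 ler_pM2l.
  have yq : rho ^+ n * y <= 2 * rho ^+ n by rewrite mulrC ler_pM2r //; lra.
  by apply/andP; split; lra.
by move=> y; rewrite /preimage /= !in_itv /=; apply: aux.
Qed.

(** A word whose interval misses [a, b] pulls it back to an interval disjoint from [0, 1], which is
    null. *)
Lemma mass_le_touching n a b :
  mass `[a, b]%classic <= word_sum p n (fun s => (word s 0 <= b) && (a <= word s 1)).
Proof.
rewrite [leLHS](mass_word n); last exact: measurable_itv.
rewrite /word_sum [leRHS]big_mkcond; apply: ler_sum => s _.
have w0 := word_weight_gt0 p p_gt0 s.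
case: ifPn => [_|].
  rewrite ger_pMr // mass_le1 //; apply: measurable_word; exact: measurable_itv.
have q0 : 0 < rho ^+ size s by rewrite exprn_gt0.
have -> : word s @^-1` `[a, b]%classic =
    `[(a - word s 0) / rho ^+ size s, (b - word s 0) / rho ^+ size s]%classic.
  apply/seteqP; split => y; rewrite /preimage /= !in_itv /= [word s y]simil_wordE;
  by rewrite ler_pdivrMr // ler_pdivlMr // lerBlDr lerBrDr [y * _]mulrC [word s 0 + _]addrC.
rewrite negb_and -!ltNge simil_word1 => H; rewrite mass_disjoint ?mulr0 //.
case/orP: H => H; [left|right]; first by rewrite ltr_pdivrMr // mul0r subr_lt0.
by rewrite ltr_pdivlMr // mul1r; lra.
Qed.

End SelfSimilarMeasure.

(** * Separation of endpoints and the upper bound for the mass of balls *)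

Section EndpointGap.
Context {R : realType} {m : nat} (rho : R) (d p : 'I_m.+1 -> R).
Context (rho01 : 0 < rho < 1).
Context (d_mono : forall i j : 'I_m.+1, (i < j)%N -> d i < d j).
Context (p_gt0 : forall j, 0 < p j) (p_sum1 : \sum_(j < m.+1) p j = 1).
Context (p_ends : p ord0 = p ord_max) (p_min : forall j, p ord0 <= p j).
Context (d0 : d ord0 = 0) (dm : d ord_max = 1 - rho).
Context (cov : forall y : R, 0 <= y <= 1 -> exists j, d j <= y <= d j + rho).

Local Notation word := (simil_word rho d).
Local Notation endpoints := (endpoints rho d).
Local Notation net := (net_intervals rho d).
Local Notation covers s D := (Defs.subitv D (word s 0, word s 1)).
Local Notation cover_weight := (cover_weight rho d p).

Let rho_gt0 : 0 < rho. Proof. by case/andP: rho01. Qed.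
Let rhoX_gt0 n : 0 < rho ^+ n. Proof. exact: exprn_gt0. Qed.

Lemma word_cover e n y : one_sided e 0 1 y ->
  exists s, size s = n /\ one_sided e (word s 0) (word s 1) y.
Proof.
move=> y01; elim: n => [|n [s [sn sy]]]; first by exists [::].
have [z zy] := word_surj rho d rho01 s y.
move: sy; rewrite -zy one_sided_word // => /(one_sided_cover rho d rho01 d_mono d0 dm cov).
move=> [j zj]; exists (rcons s j); rewrite size_rcons sn; split=> //.
by rewrite !simil_word_rcons one_sided_word // mulr0 mulr1 add0r addrC.
Qed.

Lemma word_bounds s y : 0 <= y <= 1 -> 0 <= word s y <= 1.
Proof.
move=> y01; elim: s => [//|j s /andP[s0 s1]] /=; rewrite /simil.
have /andP[dj0 dj1] := d_bounds rho d d_mono d0 dm j; have r0 := rho_gt0.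
have : 0 <= rho * word s y by rewrite mulr_ge0 // ltW.
have : rho * word s y <= rho by rewrite ger_pMr.
by move=> *; apply/andP; split; lra.
Qed.

Lemma endpoint_bounds n h : h \in endpoints n -> 0 <= h <= 1.
Proof.
move/endpointsP => [s [e [_ <-]]]; apply: word_bounds.
by case: e; rewrite /= ?lexx ?ler01.
Qed.

Lemma net_covered n D : D \in net n -> exists s, size s = n /\ covers s D.
Proof.
move=> Dn; have /netP[D1 D2 D12 _] := Dn.
have D01 : one_sided true 0 1 D.1.
  rewrite /one_sided; have /andP[-> _] /= := endpoint_bounds _ _ D1.
  apply: lt_le_trans D12 _.
  by case/andP: (endpoint_bounds _ _ D2).
have [s [sn /andP[s0 s1]]] := word_cover _ n _ D01.
by exists s; split=> //; apply/andP; split=> //=; apply: (net_right _ _ Dn sn).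
Qed.

Lemma next_endpoint n h h' : h \in endpoints n -> h' \in endpoints n -> h < h' ->
  exists2 h'', (h, h'') \in net n & h'' <= h'.
Proof.
move=> /(nthP 0)[i iL ih] /(nthP 0)[j jL jh]; have sL := endpoints_sorted rho d n.
rewrite -ih -jh lt_sorted_ltn_nth ?inE // => ij.
have iL1 : (i.+1 < size (endpoints n))%N by apply: leq_ltn_trans jL.
exists (nth 0 (endpoints n) i.+1); last by rewrite lt_sorted_leq_nth ?inE.
apply/netP; split; rewrite /= ?mem_nth //; first by rewrite lt_sorted_ltn_nth ?inE.
move=> _ /(nthP 0)[k kL <-]; rewrite !lt_sorted_leq_nth ?inE //; lia.
Qed.

(* Consecutive endpoints lie in a common S_k[0,1], so that their distances to
   S_k(0), rescaled, belong to a finite set by the finite type property. *)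
Lemma endpoint_gap : finite_type rho d ->
  exists2 c, 0 < c & forall n h h', h \in endpoints n -> h' \in endpoints n ->
    h < h' -> c * rho ^+ n <= h' - h.
Proof.
move=> [F F0 Ftype].
(* An endpoint is S_s(0) or S_s(1), and the rescaled offset of S_s(0) is f or -f with f in [F]; the
   extra 0 serves level 0. *)
pose G := flatten [seq [:: f; - f; 1 + f; 1 - f] | f <- 0 :: F].
have inG n k h : size k = n -> h \in endpoints n -> word k 0 <= h <= word k 1 ->
    rho ^- n * (h - word k 0) \in G.
  move=> kn /endpointsP[s [e [sn sh]]]; rewrite simil_word1 kn => /andP[k0 k1].
  pose v := rho ^- n * (word s 0 - word k 0).
  have hv : rho ^- n * (h - word k 0) = v + e%:R.
    by rewrite -sh [word s e%:R]simil_wordE sn addrAC mulrDr mulKf // gt_eqF.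
  have hv01 : 0 <= v + e%:R <= 1.
    by rewrite -hv mulrC ler_pdivlMr // ler_pdivrMr // mul0r mul1r subr_ge0 k0 lerBlDl.
  have vF : `|v| \in 0 :: F.
    have v1 : `|v| <= 1.
      by move: hv01; rewrite ler_norml; case: (e) => /=; lra.
    rewrite inE; case: n => [|n] in kn sn v v1 {hv hv01 k1} *.
      by rewrite /v (size0nil kn) (size0nil sn) subrr mulr0 normr0 eqxx.
    apply/orP; right.
    have vE : `|v| = rho ^- n.+1 * `|word s 0 - word k 0|.
      by rewrite normrM gtr0_norm // invr_gt0.
    (* By [d0] and [dm] the threshold of [finite_type] equals 1, so |v| <= 1 rules out its first
       alternative. *)
    have := Ftype n.+1 isT (tcast sn (in_tuple s)) (tcast kn (in_tuple k)).
    rewrite /= !val_tcast /= -vE d0 dm subr0 mulVf; last first.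
      by rewrite subr_eq0 gt_eqF //; case/andP: rho01.
    by case=> //; rewrite ltNge v1.
  rewrite hv; apply/flattenP; exists [:: `|v|; - `|v|; 1 + `|v|; 1 - `|v|].
    by apply/mapP; exists `|v|.
  rewrite !inE; case: (ger0P v) => v0; case: (e) => /=.
  - by rewrite [1 + v]addrC eqxx !orbT.
  - by rewrite addr0 eqxx.
  - by rewrite opprK [1 + v]addrC eqxx !orbT.
  - by rewrite addr0 opprK eqxx !orbT.
(* Only finitely many positive differences of offsets occur, so they have a positive lower bound. *)
pose P := [seq v <- [seq b - a | a <- G, b <- G] | 0 < v].
have [|c c0 cP] := seq_pos_lb P; first by move=> v; rewrite mem_filter => /andP[].
exists c => // n h h' hn h'n /(next_endpoint _ _ _ hn h'n)[h'' D h''h'].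
apply: (@le_trans _ _ (h'' - h)); last by rewrite lerD2r.
have [k [kn /andP[/= k0 k1]]] := net_covered _ _ D.
have /netP[_ /= h''n hh'' _] := D.
have -> : h'' - h = (rho ^- n * (h'' - word k 0) - rho ^- n * (h - word k 0)) * rho ^+ n.
  by rewrite -mulrBr mulrC mulVKf ?gt_eqF //; ring.
rewrite ler_pM2r //; apply: cP; rewrite mem_filter; apply/andP; split.
  by rewrite -mulrBr mulr_gt0 ?invr_gt0 //; lra.
apply/allpairsP; exists (rho ^- n * (h - word k 0), rho ^- n * (h'' - word k 0)) => /=.
split=> //; apply: inG => //; apply/andP; split=> //.
  exact: le_trans (ltW hh'') k1.
exact: le_trans k0 (ltW hh'').
Qed.

Context (mu : probability (measurableTypeR R) R).
Context (self_sim : self_similar rho d p mu).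
Context (supp : measure_support mu = `[0, 1]%classic).

(** By the gap at most one endpoint h lies in the ball. A word touching the ball either is counted
    at [x] or has an end at h, and the latter words are controlled by [end_weight_le]. *)
Lemma mass_ball_le e n (x r : R) : one_sided e 0 1 x -> 0 < r ->
  (forall h h', h \in endpoints n -> h' \in endpoints n -> h < h' -> 2 * r < h' - h) ->
  mass mu `[x - r, x + r]%classic <= (1 + n%:R / p ord0) * cover_weight e n x.
Proof.
move=> x01 r0 gap.
have s_end s (b : bool) : size s = n -> word s b%:R \in endpoints n.
  by move=> sn; apply/endpointsP; exists s, b.
have s_end0 s (sn : size s = n) := s_end s false sn.
have s_end1 s (sn : size s = n) := s_end s true sn.
rewrite /= in s_end0 s_end1.
have q0 : 0 <= n%:R / p ord0 by rewrite divr_ge0 // ltW.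
apply: le_trans (mass_le_touching rho d p mu rho01 p_gt0 p_sum1 self_sim supp n _ _) _.
have [/hasP[h hn /andP[hx xh]]|noh] :=
  boolP (has (fun h => x - r <= h <= x + r) (endpoints n)); last first.
  apply: (@le_trans _ _ (cover_weight e n x)); last first.
    by rewrite ler_peMl ?word_sum_ge0 // lerDl.
  apply: word_sum_le => // s sn /andP[s0 s1]; move/hasPn: noh => noh.
  have := noh _ (s_end0 _ sn); have := noh _ (s_end1 _ sn); rewrite !negb_and -!ltNge.
  rewrite !(ltNge (x + r)) s0 /= orbF (ltNge (word s 1)) s1 /= => x1 x0.
  by rewrite /one_sided; case: (e); apply/andP; split; lra.
have uniq_h h' : h' \in endpoints n -> x - r <= h' <= x + r -> h' = h.
  move=> h'n /andP[h'x xh']; case: (ltgtP h' h) => // hh; have := gap _ _ _ _ hh.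
    by move=> /(_ h'n hn); lra.
  by move=> /(_ hn h'n); lra.
(* Common to both positions of h: touching words not counted at [x] have end [b] at h, and the words
   that bound their weight, those around h, are counted at [x]. *)
have ends (b : bool) : h != b%:R ->
    (forall s, size s = n -> word s 0 <= x + r -> x - r <= word s 1 ->
       one_sided e (word s 0) (word s 1) x || (word s b%:R == h)) ->
    (forall s, size s = n -> one_sided b (word s 0) (word s 1) h ->
       one_sided e (word s 0) (word s 1) x) ->
    word_sum p n (fun s => (word s 0 <= x + r) && (x - r <= word s 1)) <=
      (1 + n%:R / p ord0) * cover_weight e n x.
  move=> hb touch near_h.
  apply: (@le_trans _ _ (cover_weight e n x + end_weight rho d p b n h)).
    apply: le_trans (word_sumU p p_gt0 _ _ _); apply: word_sum_le => // s sn /andP[].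
    exact: touch.
  rewrite mulrDl mul1r lerD2l.
  apply: le_trans (end_weight_le rho d p rho01 d_mono p_gt0 p_sum1 p_ends p_min d0 dm cov b n h hb) _.
  by apply: ler_wpM2l => //; apply: word_sum_le.
(* For h left of [x] the uncounted words stop at h, for h right of [x] they start there; the tie h =
   x is decided by the open side of [one_sided e]. *)
case: (boolP (if e then h <= x else h < x)) => hside.
  apply: (ends true).
  - by apply/negbT/lt_eqF => /=; move: x01 hside; rewrite /one_sided; case: (e) => /andP[? ?] ?; lra.
  - move=> s sn s0 s1; rewrite orbC -implyNb; apply/implyP => /= s1h.
    have u0 := uniq_h _ (s_end0 _ sn); have u1 := uniq_h _ (s_end1 _ sn).
    have s1r : x + r < word s 1.
      by rewrite ltNge; apply: contra s1h => s1'; apply/eqP/u1/andP.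
    have s0r : word s 0 < x - r \/ word s 0 = h.
      by case: (ltP (word s 0) (x - r)) => [|s0']; [left|right; apply/u0/andP].
    by move: hside s0r; rewrite /one_sided; case: (e) => ? [?|?]; apply/andP; split; lra.
  - move=> s sn /andP[s0h hs1].
    have s1r : x + r < word s 1.
      rewrite ltNge; apply/negP => s1'.
      have e' := uniq_h _ (s_end1 _ sn).
      by have : word s 1 = h by [apply: e'; apply/andP; split; lra]; lra.
    by move: hside; rewrite /one_sided; case: (e) => ?; apply/andP; split; lra.
have {}hside : if e then x < h else x <= h.
  by move: hside; case: (e); rewrite -?ltNge -?leNgt.
apply: (ends false).
- by apply/negbT/gt_eqF => /=; move: x01 hside; rewrite /one_sided; case: (e) => /andP[? ?] ?; lra.
- move=> s sn s0 s1; rewrite orbC -implyNb; apply/implyP => /= s0h.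
  have u0 := uniq_h _ (s_end0 _ sn); have u1 := uniq_h _ (s_end1 _ sn).
  have s0r : word s 0 < x - r.
    by rewrite ltNge; apply: contra s0h => s0'; apply/eqP/u0/andP.
  have s1r : x + r < word s 1 \/ word s 1 = h.
    by case: (ltP (x + r) (word s 1)) => [|s1']; [left|right; apply/u1/andP].
  by move: hside s1r; rewrite /one_sided; case: (e) => ? [?|?]; apply/andP; split; lra.
- move=> s sn /andP[s0h hs1].
  have s0r : word s 0 < x - r.
    rewrite ltNge; apply/negP => s0'.
    have e' := uniq_h _ (s_end0 _ sn).
    by have : word s 0 = h by [apply: e'; apply/andP; split; lra]; lra.
  by move: hside; rewrite /one_sided; case: (e) => ?; apply/andP; split; lra.
Qed.

End EndpointGap.

(** * From linear growth of logarithms to the limit of a ratio of logarithms *)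

Section Asymptotics.
Context {R : realType}.

(** Monotonicity and the bounded drop [l] keep [b] within k l of the preceding value of the
    subsequence; this and the finitely many n < n0 go into the constant. *)
Lemma subsequence_growth (b : nat -> R) (l L v : R) n0 k : (0 < k)%N ->
  (forall n, b n.+1 <= b n) -> (forall n, b n - l <= b n.+1) -> 0 <= l ->
  k%:R * L = v ->
  (forall e, 0 < e -> exists C, forall N,
     `|b (n0 + k * N)%N - N%:R * v| <= e * N%:R + C) ->
  forall e, 0 < e -> exists C, forall n, `|b n - n%:R * L| <= e * n%:R + C.
Proof.
move=> k0 bdec bl l0 kL H e e0; have [C HC] := H e e0.
have bd i n : b (n + i)%N <= b n /\ b n - i%:R * l <= b (n + i)%N.
  elim: i => [|i [IH1 IH2]]; first by rewrite addn0 mul0r subr0.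
  rewrite addnS -natr1 mulrDl mul1r; have := bdec (n + i)%N; have := bl (n + i)%N.
  by move=> *; split; lra.
have n0L : 0 <= (n0 + k)%:R * (`|L| + l) by rewrite mulr_ge0 // addr_ge0.
exists (`|C| + `|b 0| + (n0 + k)%:R * (`|L| + l)) => n.
have en : 0 <= e * n%:R by rewrite mulr_ge0 // ltW.
have Labs j : (j <= n0 + k)%N -> `|j%:R * L| <= (n0 + k)%:R * `|L|.
  by move=> jk; rewrite normrM normr_nat ler_wpM2r // ler_nat.
have labs j : (j <= n0 + k)%N -> 0 <= j%:R * l <= (n0 + k)%:R * l.
  by move=> jk; rewrite mulr_ge0 //= ler_wpM2r // ler_nat.
have C0 := ler_norm C; have C1 := normr_ge0 C.
rewrite mulrDr in n0L *.
case: (leqP n0 n) => [n0n|nn0]; last first.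
  have nk : (n <= n0 + k)%N by lia.
  have := Labs n nk; have /andP[] := labs n nk; have [] := bd n 0%N; rewrite add0n.
  have := ler_norm (b 0); have := ler_norm (- b 0); rewrite normrN.
  by rewrite !ler_norml => ? ? ? ? ? ? /andP[? ?]; apply/andP; split; lra.
pose N := ((n - n0) %/ k)%N; pose i := ((n - n0) %% k)%N.
have nE : n = (n0 + k * N + i)%N by rewrite -addnA mulnC -divn_eq subnKC.
have ik : (i < k)%N by rewrite ltn_mod.
have Nn : (N <= n)%N by apply: leq_trans (leq_div _ _) (leq_subr _ _).
have iik : (i <= n0 + k)%N by lia.
have nik : (n0 + i <= n0 + k)%N by lia.
have eN : e * N%:R <= e * n%:R by rewrite ler_pM2l // ler_nat.
have nL : n%:R * L = (n0 + i)%:R * L + N%:R * v.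
  by rewrite -kL {1}nE -addnA [(k * N + i)%N]addnC addnA natrD mulrDl natrM; ring.
have := HC N; have := Labs _ nik; have /andP[] := labs _ iik.
have [] := bd i (n0 + k * N)%N; rewrite -nE nL.
have := normr_ge0 (b 0).
by rewrite !ler_norml => ? ? ? ? ? /andP[? ?] /andP[? ?]; apply/andP; split; lra.
Qed.

(** Follows from 1 + n q <= (1 + e n)(1 + q / e) and 1 + t <= exp t. *)
Lemma ln_succ_le (q e : R) : 0 < q -> 0 < e ->
  exists2 C, 0 <= C & forall n : nat, ln (1 + n%:R * q) <= e * n%:R + C.
Proof.
move=> q0 e0; have qe : 0 < q / e by rewrite divr_gt0.
exists (ln (1 + q / e)); first by rewrite ln_ge0 // lerDl ltW.
move=> n; rewrite -[e * _]expRK -lnM ?posrE ?expR_gt0 ?addr_gt0 //.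
have nq : 0 <= n%:R * q by rewrite mulr_ge0 // ltW.
have en : 0 <= e * n%:R by rewrite mulr_ge0 // ltW.
rewrite ler_ln ?posrE ?mulr_gt0 ?expR_gt0 //; try lra.
apply: (@le_trans _ _ ((1 + e * n%:R) * (1 + q / e))); last first.
  by rewrite ler_pM2r ?expR_ge1Dx //; lra.
have -> : (1 + e * n%:R) * (1 + q / e) = 1 + n%:R * q + e * n%:R + q / e.
  by field; rewrite gt_eqF.
by lra.
Qed.

(** Write r = rho^t. Integers n and n' at bounded distance from t satisfy 2 rho^n <= r <= c rho^n',
    so ln F(r) equals t L up to a small multiple of t and a constant; the factor 1 + n q is
    subexponential. *)
Lemma log_ratio_cvg (F : R -> R) (a : nat -> R) (rho L c q : R) :
  0 < rho < 1 -> 0 < c -> 0 < q -> (forall n, 0 < a n) ->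
  (forall e, 0 < e -> exists C, forall n, `|ln (a n) - n%:R * L| <= e * n%:R + C) ->
  (forall r s, r <= s -> F r <= F s) ->
  (forall n, a n <= F (2 * rho ^+ n)) ->
  (forall n, F (c * rho ^+ n) <= (1 + n%:R * q) * a n) ->
  ln (F r) / ln r @[r --> 0^'+] --> L / ln rho.
Proof.
move=> /andP[rho0 rho1] c0 q0 a0 aL Fmono Flo Fup.
have [lr lrE] : exists lr, ln rho = - lr by exists (- ln rho); rewrite opprK.
have lr0 : 0 < lr by rewrite -oppr_lt0 -lrE ln_lt0 // rho0.
apply/cvgrPdist_le => eta eta0.
(* The error 2 e t + D must stay below eta t lr: this [e] spends one half, and t > [T] leaves the
   other half to [D]. *)
have [e eE] : exists e, e = eta * lr / 4 by exists (eta * lr / 4).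
have e0 : 0 < e by rewrite eE divr_gt0 // mulr_gt0.
have [C aC] := aL e e0; have [C2 C20 lnC] := ln_succ_le q e q0 e0.
pose K := 1 + `|ln 2 / lr| + `|ln c / lr|.
pose D := K * `|L| + 2 * e * K + `|C| + C2.
pose T := 2 * D / (eta * lr).
have K1 : 1 <= K by rewrite /K -addrA lerDl addr_ge0.
have eK : 0 <= e * K by rewrite mulr_ge0 //; [apply: ltW|lra].
have KL : 0 <= K * `|L| by rewrite mulr_ge0 //; lra.
have D0 : 0 <= D by rewrite /D !addr_ge0 // -mulrA mulr_ge0.
have T0 : 0 <= T by rewrite divr_ge0 ?mulr_ge0 // ltW // mulr_gt0.
near=> r.
have r0 : 0 < r by near: r; exact: nbhs_right_gt.
have r1 : r < 1 by near: r; apply: nbhs_right_lt.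
have r2 : r < 2 by near: r; apply: nbhs_right_lt.
have rc : r < c by near: r; apply: nbhs_right_lt.
have rT : r < expR (- ((T + 1) * lr)) by near: r; apply: nbhs_right_lt; apply: expR_gt0.
have [t lnr] : exists t, ln r = - (t * lr).
  by exists (- ln r / lr); rewrite divfK ?opprK // gt_eqF.
have Tt : T < t.
  rewrite -(ltr_pM2r lr0); have : (T + 1) * lr < t * lr.
    by rewrite -ltrN2 -lnr -ltr_expR lnK ?posrE.
  by rewrite mulrDl mul1r; lra.
have t0 : 0 < t by apply: le_lt_trans Tt.
have lnX y (n : nat) : 0 < y -> ln (y * rho ^+ n) = ln y - n%:R * lr.
  by move=> y0; rewrite lnM ?posrE ?exprn_gt0 // lnXn // lrE mulNrn mulr_natl.
have ball2 (n : nat) : t + ln 2 / lr <= n%:R -> 2 * rho ^+ n <= r.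
  rewrite -(ler_pM2r lr0) mulrDl divfK ?gt_eqF // => h.
  by rewrite -ler_ln ?posrE ?mulr_gt0 ?exprn_gt0 // lnX // lnr; lra.
have ballc (n : nat) : n%:R <= t + ln c / lr -> r <= c * rho ^+ n.
  rewrite -(ler_pM2r lr0) mulrDl divfK ?gt_eqF // => h.
  by rewrite -ler_ln ?posrE ?mulr_gt0 ?exprn_gt0 // lnX // lnr; lra.
have Fn (n : nat) : t + ln 2 / lr <= n%:R -> a n <= F r.
  move=> /ball2 nr; apply: le_trans (Flo n) _.
  exact: Fmono.
have t2 : 0 <= t + ln 2 / lr.
  by rewrite addr_ge0 ?(ltW t0) // divr_ge0 ?(ltW lr0) // ln_ge0 // ler1n.
have tc : 0 <= t + ln c / lr.
  have : ln r <= ln c by rewrite ler_ln ?posrE // ltW.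
  by rewrite lnr => h; rewrite -(pmulr_lge0 _ lr0) mulrDl divfK ?gt_eqF //; lra.
have [n [tn1 tn2]] : exists n : nat, t + ln 2 / lr <= n%:R /\ n%:R <= t + ln 2 / lr + 1.
  exists (Num.truncn (t + ln 2 / lr)).+1.
  by rewrite (ltW (truncnS_gt _)) -natr1 lerD2r truncn_le.
have F0 : 0 < F r by apply: lt_le_trans (Fn n tn1).
have low : ln (a n) <= ln (F r) by rewrite ler_ln ?posrE // Fn.
have [n' [tn1' tn2']] : exists n : nat, n%:R <= t + ln c / lr /\ t + ln c / lr <= n%:R + 1.
  exists (Num.truncn (t + ln c / lr)).
  by rewrite truncn_le // natr1 (ltW (truncnS_gt _)).
have up : ln (F r) <= e * n'%:R + C2 + ln (a n').
  have nr := ballc n' tn1'.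
  have Fn' : F r <= (1 + n'%:R * q) * a n'.
    by apply: le_trans (Fup n'); apply: Fmono => //; rewrite ?inE ?mulr_gt0 ?exprn_gt0.
  have nq : 0 < 1 + n'%:R * q by rewrite ltr_pwDl // mulr_ge0 // ltW.
  apply: (@le_trans _ _ (ln (1 + n'%:R * q) + ln (a n'))).
    by rewrite -lnM ?posrE // ler_ln ?posrE ?mulr_gt0.
  by rewrite lerD2r.
have nearK (z j : R) : 1 + `|z| <= K -> t + z - 1 <= j <= t + z + 1 -> `|j - t| <= K.
  have := ler_norm z; have := ler_norm (- z); rewrite normrN.
  by clear => ? ? ? /andP[? ?]; rewrite ler_norml; apply/andP; split; lra.
have nt : `|n%:R - t| <= K.
  apply: (nearK (ln 2 / lr)); first by rewrite /K lerDl.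
  by rewrite tn2 andbT (le_trans _ tn1) // gerBl.
have nt' : `|n'%:R - t| <= K.
  apply: (nearK (ln c / lr)); first by rewrite /K addrAC lerDl.
  by rewrite lerBlDr tn2' (le_trans tn1') // lerDl.
have scale j : `|j%:R - t| <= K -> `|j%:R * L - t * L| <= K * `|L| /\ e * j%:R <= e * t + e * K.
  move=> jt; split; first by rewrite -mulrBl normrM ler_wpM2r.
  by rewrite -mulrDr ler_pM2l //; move: jt; rewrite ler_norml => /andP[]; lra.
have [s1 s2] := scale _ nt; have [s1' s2'] := scale _ nt'.
have main : `|ln (F r) - t * L| <= 2 * e * t + D.
  have et0 : 0 <= e * t by rewrite ltW // mulr_gt0.
  have := aC n; have := aC n'; have := ler_norm C; move: s1 s1' s2 s2' low up.
  rewrite /D -!mulrA !ler_norml.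
  move: (K * `|L|) (e * K) (`|C|) (e * t) (t * L) (n%:R * L) (n'%:R * L)
    (e * n%:R) (e * n'%:R) eK et0 C20.
  clear => ? ? ? ? ? ? ? ? ? ? ? ? /andP[? ?] /andP[? ?] ? ? ? ? ? /andP[? ?] /andP[? ?].
  by apply/andP; split; lra.
have -> : L / ln rho - ln (F r) / ln r = (ln (F r) - t * L) / (t * lr).
  by rewrite lrE lnr; field; rewrite !gt_eqF.
rewrite normrM [`|(t * lr)^-1|]gtr0_norm ?invr_gt0 ?mulr_gt0 //.
rewrite ler_pdivrMr ?mulr_gt0 //; apply: le_trans main _.
have Dt : 2 * D <= t * (eta * lr).
  by rewrite -ler_pdivrMr ?mulr_gt0 // ltW.
have et : e * t = eta * lr * t / 4 by rewrite eE; field.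
have -> : eta * (t * lr) = t * (eta * lr) by ring.
by rewrite -mulrA et; lra.
Unshelve. all: by end_near.
Qed.

End Asymptotics.

(** * Growth rate of the covering weights along a periodic path *)

Section PeriodicPoints.
Context {R : realType} {m : nat} (rho : R) (d p : 'I_m.+1 -> R).
Context (rho01 : 0 < rho < 1).
Context (d_mono : forall i j : 'I_m.+1, (i < j)%N -> d i < d j).
Context (p_gt0 : forall j, 0 < p j) (p_sum1 : \sum_(j < m.+1) p j = 1).
Context (p_min : forall j, p ord0 <= p j).
Context (d0 : d ord0 = 0) (dm : d ord_max = 1 - rho).
Context (cov : forall y : R, 0 <= y <= 1 -> exists j, d j <= y <= d j + rho).
Context (g : charvec R) (w : seq (charvec R)) (Delta : nat -> R * R) (n0 : nat).
Context (Delta_chain : forall n, parent_child rho d n (Delta n) (Delta n.+1)).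
Context (Delta_period : forall i, characteristic rho d (n0 + i) (Delta (n0 + i)%N) =
  nth g (g :: w) (i %% size (g :: w))).

Local Notation k := (size (g :: w)).
Local Notation T := (transition rho d p g w g).
Local Notation cover_vector := (cover_vector rho d p).

Lemma cover_vector_period N :
  cover_vector g (n0 + k * N) (Delta (n0 + k * N)%N) =
  p ord0 ^+ (k * N) *: (cover_vector g n0 (Delta n0) *m T ^+ N).
Proof.
elim: N => [|N IH]; first by rewrite muln0 addn0 !expr0 mulmx1 scale1r.
rewrite mulnS [(k + _)%N]addnC addnA.
rewrite (cover_vector_path rho d p rho01 d_mono p_gt0 d0 dm Delta w _ g g Delta_chain).
  rewrite IH -scalemxAl scalerA -exprD addnC -mulmxA; congr (_ *: (_ *m _)).
  by rewrite exprSr.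
move=> i; rewrite -addnA Delta_period [(k * N)%N]mulnC modnMDl.
(* The index i = k closes the cycle: it is the last letter of theta and the first letter of the next
   turn. *)
rewrite leq_eqVlt => /predU1P[->|ik].
  by rewrite modnn /= nth_rcons ltnn eqxx.
rewrite modn_small //; case: i ik => //= i ik.
by rewrite nth_rcons; move: ik; rewrite ltnS => ->.
Qed.

(** Along multiples of the period the covering weight is p_0^(kN) times the entry sum of v T^N.
    Since a level costs at most the factor p_0, that sum stays above the weight at level n0, as
    [spectral_radius_growth] requires. *)
Lemma periodic_growth e x : one_sided e 0 1 x ->
  (forall n, (n0 <= n)%N ->
     word_sum p n (fun s => Defs.subitv (Delta n) (simil_word rho d s 0, simil_word rho d s 1)) =
     cover_weight rho d p e n x) ->
  forall eps, 0 < eps -> exists C, forall n,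
    `|ln (cover_weight rho d p e n x) -
        n%:R * (ln (p ord0) + ln (spectral_radius T) / k%:R)| <= eps * n%:R + C.
Proof.
move=> x01 cw; pose a n := cover_weight rho d p e n x.
have a_gt0 n : 0 < a n := cover_weight_gt0 rho d p rho01 d_mono p_gt0 p_min d0 dm cov e n x x01.
have a_ge n : p ord0 * a n <= a n.+1 := cover_weight_ge rho d p rho01 d_mono p_gt0 p_min d0 dm cov e n x.
have a_le n : a n.+1 <= a n := cover_weight_le rho d p rho01 d_mono p_gt0 p_sum1 d0 dm e n x.
have p0 := p_gt0 ord0.
have gE N : characteristic rho d (n0 + k * N) (Delta (n0 + k * N)%N) = g.
  by rewrite Delta_period mulnC modnMl.
pose v := cover_vector g n0 (Delta n0).
have v_gt0 i : 0 < v 0 i.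
  move: i; rewrite /v; have := gE 0%N; rewrite muln0 addn0 => <- i.
  exact: cover_vector_gt0.
pose u N := \sum_i (v *m T ^+ N) 0 i.
have auN N : a (n0 + k * N)%N = p ord0 ^+ (k * N) * u N.
  rewrite /a -cw ?leq_addr // -cover_vector_sum.
  transitivity (\sum_i cover_vector g (n0 + k * N) (Delta (n0 + k * N)%N) 0 i).
    by rewrite gE.
  by rewrite cover_vector_period mulr_sumr; apply: eq_bigr => i _; rewrite mxE.
have a_pow n : p ord0 ^+ n * a n0 <= a (n0 + n)%N.
  elim: n => [|n IH]; first by rewrite expr0 mul1r addn0.
  by rewrite exprS -mulrA addnS; apply: le_trans (a_ge _); rewrite ler_pM2l.
have u_ge N : a n0 <= u N.
  by rewrite -(ler_pM2l (exprn_gt0 (k * N) p0)) -auN; apply: a_pow.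
(* Without neighbours [u 0] would be an empty sum, contrary to its positive lower bound. *)
have size_g : (0 < size (cv_nbs g))%N.
  rewrite lt0n; apply/negP => /eqP s0; have := u_ge 0%N; rewrite leNgt => /negP; apply.
  rewrite /u big1 ?a_gt0 // => i _.
  by have := ltn_ord i; rewrite [X in (_ < X)%N]s0.
have [sp1 growth] := spectral_radius_growth _ T v (a n0) size_g
  (transition_ge0 rho d p p_gt0 g w g) v_gt0 (a_gt0 n0) u_ge.
have kR : k%:R != 0 :> R by rewrite pnatr_eq0.
have p1 : p ord0 <= 1.
  by rewrite -p_sum1 (bigD1 ord0) //= lerDl sumr_ge0 // => j _; apply: ltW.
(* Per level the logarithm drops by at most -ln p_0; per period the rate is k ln p_0 + ln sp. *)
apply: (@subsequence_growth _ (fun n => ln (a n)) (- ln (p ord0)) _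
   (k%:R * ln (p ord0) + ln (spectral_radius T)) n0 k).
- by [].
- by move=> n; rewrite ler_ln ?posrE.
- by move=> n; rewrite opprK addrC -lnM ?posrE // ler_ln ?posrE ?mulr_gt0.
- by rewrite oppr_ge0 ln_le0.
- by rewrite mulrDr mulrCA divff ?mulr1.
move=> eps eps0; have [C HC] := growth eps eps0; exists C => N.
have uN : 0 < u N by apply: lt_le_trans (u_ge N).
rewrite auN lnM ?posrE ?exprn_gt0 // lnXn // -[_ *+ (k * N)]mulr_natl natrM.
have -> : k%:R * N%:R * ln (p ord0) + ln (u N) - N%:R * (k%:R * ln (p ord0) + ln (spectral_radius T)) =
  ln (u N) - N%:R * ln (spectral_radius T) by ring.
exact: HC.
Qed.

End PeriodicPoints.

(** * Assembly: choice of a side of the point, growth rate, local dimension *)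

Theorem proposition4p14 (R : realType) (m : nat) (rho : R)
    (d p : 'I_m.+1 -> R) (mu : probability (measurableTypeR R) R)
    (hm : (1 <= m)%N)
    (hrho : 0 < rho < 1)
    (hd : forall i j : 'I_m.+1, (i < j)%N -> d i < d j)
    (hp : forall j, 0 < p j)
    (hp1 : \sum_(j < m.+1) p j = 1)
    (hmu : self_similar rho d p mu)
    (hfin : finite_type rho d)
    (hreg : p ord0 = p ord_max /\ forall j, p ord0 <= p j)
    (hsupp : measure_support mu = `[0, 1]%classic)
    (x : R) (hx : x \in `[0, 1])
    (g : charvec R) (w : seq (charvec R))
    (hper : periodic_point rho d x g w) :
  has_local_dimension mu x
    (ln (p ord0) / ln rho +
     ln (spectral_radius (transition rho d p g w g)) /
       ((size (g :: w))%:R * ln rho)).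
Proof.
have [p_ends p_min] := hreg.
have d0 := d_first rho d p mu hrho hd hp hp1 hmu hsupp.
have dm := d_last rho d p mu hrho hd hp hp1 hmu hsupp.
have cov := simil_covering rho d p mu hrho hp hp1 hmu hsupp.
have [_ [gamma [Delta rep] [s gammaE]]] := hper.
have chain n : parent_child rho d n (Delta n) (Delta n.+1) by case: (rep n).
have Dnet n : Delta n \in net_intervals rho d n by case: (rep n).
have xD n : (Delta n).1 <= x <= (Delta n).2.
  by case: (rep n) => _; rewrite in_itv.
have D01 n : 0 <= (Delta n).1 /\ (Delta n).2 <= 1.
  have /netP[D1 D2 _ _] := Dnet n.
  have /andP[? _] := endpoint_bounds rho d hrho hd d0 dm n _ D1.
  by have /andP[_ ?] := endpoint_bounds rho d hrho hd d0 dm n _ D2.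
pose k := size (g :: w).
have period N i : characteristic rho d (s.+1 + k * N + i) (Delta (s.+1 + k * N + i)%N) =
    nth g (g :: w) (i %% size (g :: w)).
  case: (rep (s.+1 + k * N + i)%N) => _ _ _ <-.
  by rewrite -addnA gammaE mulnC modnMDl.
have [e [N [x01 cw]]] : exists e N, one_sided e 0 1 x /\ forall n, (s.+1 + k * N <= n)%N ->
    word_sum p n (fun s => Defs.subitv (Delta n) (simil_word rho d s 0, simil_word rho d s 1)) =
     cover_weight rho d p e n x.
  have [xlt|] := pselect (forall n, x < (Delta n).2).
    exists true, 0%N; split=> [|n _].
      have [? ?] := D01 0%N; have /andP[? ?] := xD 0%N; have ? := xlt 0%N.
      by rewrite /one_sided; apply/andP; split; lra.
    by apply: cover_weight_left => //; rewrite xlt andbT; case/andP: (xD n).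
  move=> /existsNP[n1 /negP]; rewrite -leNgt => xn1.
  have xge n : (n1 <= n)%N -> (Delta n).2 <= x.
    elim: n => [|n IH]; first by rewrite leqn0 => /eqP <-.
    rewrite leq_eqVlt => /predU1P[<- //|/IH]; apply: le_trans.
    by case: (chain n) => _ _ /andP[].
  exists false, n1; split=> [|n nn].
    have [? ?] := D01 n1; have /andP[? ?] := xD n1; have ? := net_lt _ _ (Dnet n1).
    by rewrite /one_sided; apply/andP; split; lra.
  apply: cover_weight_right => //; have /andP[D1x ->] := xD n; rewrite andbT.
  apply: lt_le_trans (net_lt _ _ (Dnet n)) (xge n _); apply: leq_trans nn.
  by rewrite (leq_trans _ (leq_addl _ _)) // leq_pmull.
have growth := periodic_growth rho d p hrho hd hp hp1 p_min d0 dm cov g w Delta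
  (s.+1 + k * N)%N chain (period N) e x x01 cw.
have [c c0 gap] := endpoint_gap rho d hrho hd d0 dm cov hfin.
have rho0 : 0 < rho by case/andP: hrho.
have -> : ln (p ord0) / ln rho + ln (spectral_radius (transition rho d p g w g)) /
       ((size (g :: w))%:R * ln rho) =
   (ln (p ord0) + ln (spectral_radius (transition rho d p g w g)) / k%:R) / ln rho.
  have kR : k%:R != 0 :> R by rewrite pnatr_eq0.
  have lr : ln rho != 0 by rewrite lt_eqF // ln_lt0.
  by rewrite -/k; field; rewrite lr kR.
rewrite /has_local_dimension.
(* With radius (c / 3) rho^n the ball is shorter than the gap c rho^n between endpoints. *)
apply: (log_ratio_cvg (fun r => mass mu `[x - r, x + r]%classic)
   (fun n => cover_weight rho d p e n x) rho _ (c / 3) (p ord0)^-1) => //.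
- by rewrite divr_gt0.
- by rewrite invr_gt0.
- by move=> n; apply: (cover_weight_gt0 rho d p hrho hd hp p_min d0 dm cov).
- move=> r r' rr'; apply: mass_le; try exact: measurable_itv.
  by move=> y /=; rewrite !in_itv /= => /andP[? ?]; apply/andP; split; lra.
- by move=> n; apply: (mass_ball_ge rho d p mu hrho hp hp1 hmu hsupp).
move=> n; apply: (mass_ball_le rho d p hrho hd hp hp1 p_ends p_min d0 dm cov mu hmu hsupp) => //.
  by rewrite mulr_gt0 ?divr_gt0 ?exprn_gt0.
move=> h h' hn h'n hh'; apply: lt_le_trans (gap _ _ _ hn h'n hh').
by rewrite mulrA ltr_pM2r ?exprn_gt0 //; lra.
Qed.
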